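(* Let $L_n=\{(a,0):0\le a\le n-1\}$ be the horizontal line of $n$ consecutive cells, and let $G_n$ be the graph whose vertex set is $\gamma(L_n)$ and in which two patterns are adjacent when one is obtained from the other by a single solitaire move. Then the diameter of $G_n$ is $\Theta(n^3)$, i.e. there are constants $0<c<C$ such that $c\,n^3\le \operatorname{diam}(G_n)\le C\,n^3$ for all sufficiently large $n$.
   Context: A pattern is a finite subset $P\subset\mathbb{Z}^2$. Let $T=\{(0,1),(1,1),(1,0)\}$. A solitaire move applies to $P$ at $v\in\mathbb{Z}^2$ when $|P\cap(v+T)|=2$, and replaces $P$ by $(P\setminus(v+T))\cup S$ for an arbitrary two-element subset $S\subset v+T$; $\gamma(P)$ is the set of patterns reachable from $P$ by finitely many moves. *)

(* Defs.v *)
From mathcomp Require Import all_boot all_order all_algebra.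
From mathcomp Require Import finmap reals.

Set Implicit Arguments.
Unset Strict Implicit.
Unset Printing Implicit Defensive.

Import Order.TTheory GRing.Theory Num.Theory.

Local Open Scope fset_scope.
Local Open Scope ring_scope.

Record graph (V : Type) := Graph {
  vertex : V -> Prop;
  adj : V -> V -> Prop }.

Inductive walk (V : Type) (G : graph V) : nat -> V -> V -> Prop :=
| walk_nil x : vertex G x -> walk G 0%N x x
| walk_cons k x y z :
    vertex G x -> adj G x y -> walk G k y z -> walk G k.+1 x z.

Definition is_distance (V : Type) (G : graph V) (x y : V) (d : nat) : Prop :=
  walk G d x y /\ forall k, walk G k x y -> (d <= k)%N.

(* Determines d uniquely, and forces G to be nonempty, connected and of finite
   diameter. *)
Definition is_diameter (V : Type) (G : graph V) (d : nat) : Prop :=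
  (forall x y, vertex G x -> vertex G y ->
     exists2 k, is_distance G x y k & (k <= d)%N) /\
  (exists x y, [/\ vertex G x, vertex G y & is_distance G x y d]).

Definition cell : Type := (int * int)%type.
Definition pattern : Type := {fset int * int}.

Definition T : pattern := [fset (0, 1); (1, 1); (1, 0)].

Definition translate (v : cell) (A : pattern) : pattern :=
  [fset ((v.1 + t.1, v.2 + t.2) : int * int) | t in A].

Definition solitaire_move (P Q : pattern) : Prop :=
  exists (v : cell) (S : pattern),
    [/\ #|` P `&` translate v T| = 2%N,
        S `<=` translate v T,
        #|` S| = 2%N
      & Q = (P `\` translate v T) `|` S].

Inductive gamma (P : pattern) : pattern -> Prop :=
| gamma_refl : gamma P P
| gamma_step Q Q' : gamma P Q -> solitaire_move Q Q' -> gamma P Q'.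

Definition L (n : nat) : pattern :=
  [fset ((a%:Z, 0) : int * int) | a in iota 0 n].

(* A move may choose S = P :&: (v + T); P <> Q discards the resulting loops. *)
Definition solitaire_graph (n : nat) : graph pattern :=
  {| vertex := gamma (L n);
     adj := fun P Q => P <> Q /\ (solitaire_move P Q \/ solitaire_move Q P) |}.

(* Main.v *)
Require Import Defs.
From mathcomp Require Import all_boot all_order all_algebra.
From mathcomp Require Import finmap reals.
From mathcomp Require Import boolp zify ring.

Set Implicit Arguments.
Unset Strict Implicit.
Unset Printing Implicit Defensive.

Import Order.TTheory GRing.Theory Num.Theory.
Local Open Scope fset_scope.
Local Open Scope ring_scope.

(**
  A solitaire move slides one token within a translate of [T] that holds two
  tokens. A triangle of side [s] (a translate of the [s]-fold enlargement of [T])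
  never holds more than [s] tokens in the orbit of a line.

  Upper bound. A line of tokens on a side of a triangle can be rolled over an
  adjacent token, or onto another side, so two touching triangles whose tokens lie
  on their top rows merge in [O(n ^ 2)] moves into one triangle with its tokens on
  its top row. Starting from the [n] single tokens, at most [n] merges lead to [L n].

  Lower bound. Take a spiral in which token [i.+1] touches the triangle spanned by
  the previous tokens only at a corner, the [i]-th gate, the three corners being
  used in turn. The tokens beyond gate [i] stay put until that gate is first
  visited, and at that time the new side of the next triangle is empty up to one
  end, while its gate is the other end. A triangular window at a gate can be
  crossed only when it holds as many tokens as its side: the set filled by its
  tokens changes only when a token enters through the inner side of the window, and
  the gate becomes filled through a full triangle reaching from that side to it.
  Three disjoint, well separated windows of total side more than the number of
  available tokens have to be saturated in turn, so each turn of the spiral costs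
  quadratically many moves.
*)

(** * Moves and triangles *)

(** A triple of side zero or less has no cells, but its side keeps a meaning: for an intersection of
    two triangles it measures the gap between them. *)
Definition tri : Type := (int * int * int)%type.

Definition intri (K : tri) (c : cell) : bool :=
  [&& c.1 <= K.1.1, c.2 <= K.1.2 & K.2 <= c.1 + c.2].

Definition side (K : tri) : int := K.1.1 + K.1.2 - K.2 + 1.

Definition cellT (v : cell) : tri := (v.1 + 1, v.2 + 1, v.1 + v.2 + 1).

(** A token jumps from [a] to [b] while the token [c] stays; exchanging [a] and [b] reverses the
    step. *)
Definition step_at (v a b c : cell) (P Q : pattern) : Prop :=
  [/\ [/\ intri (cellT v) a, intri (cellT v) b & intri (cellT v) c],
      [/\ a \in P, c \in P, a != c & b \notin P]
    & Q = b |` (P `\ a)].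

Definition step (P Q : pattern) : Prop := exists v a b c, step_at v a b c P Q.

Lemma cell_eqE (a b : cell) : (a == b) = (a.1 == b.1) && (a.2 == b.2).
Proof. by case: a b => [? ?] [? ?]; rewrite xpair_eqE. Qed.

Lemma cell_eqP (a b : cell) : a.1 = b.1 -> a.2 = b.2 -> a = b.
Proof. by case: a b => [? ?] [? ?] /= -> ->. Qed.

Lemma in_translateT v c : (c \in translate v T) = intri (cellT v) c.
Proof.
apply/imfsetP/idP => [[t] | ].
  by rewrite !inE => /orP[/orP[]|] /eqP-> ->; rewrite /intri /=; lia.
case: v c => [v w] [x y] /= h; rewrite /intri /= in h.
exists (x - v, y - w); last by apply: cell_eqP; rewrite /=; lia.
by rewrite !inE !cell_eqE /=; lia.
Qed.

Lemma cardfs3 (a b c : cell) : a != b -> a != c -> b != c ->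
  #|` [fset a; b; c]| = 3%N.
Proof.
by move=> ab ac bc; rewrite fsetUC cardfsU1 cardfs2 ab !inE ![c == _]eq_sym (negPf ac) (negPf bc).
Qed.

Lemma card_translateT v : #|` translate v T| = 3%N.
Proof.
rewrite card_imfset; last by case=> [x y] [x' y'] /= []; move=> *; apply: cell_eqP => /=; lia.
by rewrite cardfs3 ?cell_eqE.
Qed.

Lemma step_at_sym v a b c P Q : step_at v a b c P Q -> step_at v b a c Q P.
Proof.
move=> [[Ta Tb Tc] [aP cP ac bP] ->].
have ab : a != b by apply: contraNneq bP => <-.
have cb : c != b by apply: contraNneq bP => <-.
split=> //.
  by rewrite !inE !eqxx (negPf ab) cP [c == a]eq_sym (negPf ac) orbT [b == c]eq_sym cb.
apply/fsetP => x; rewrite !inE; case: (eqVneq x a) => [->|_] /=; first by rewrite aP.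
by case: (eqVneq x b) => [->|_] //=; apply/negbTE.
Qed.

Lemma step_sym P Q : step P Q -> step Q P.
Proof. by move=> [v [a [b [c /step_at_sym st]]]]; exists v, b, a, c. Qed.

Lemma step_neq P Q : step P Q -> P <> Q.
Proof.
move=> [v [a [b [c [_ [_ _ _ bP] ->]]]]] E.
by move: bP; rewrite E !inE eqxx.
Qed.

Lemma step_card P Q : step P Q -> #|` Q| = #|` P|.
Proof.
move=> [v [a [b [c [_ [aP _ _ bP] ->]]]]].
by rewrite cardfsU1 !inE (negPf bP) andbF /= (cardfsD1 a P) aP.
Qed.

Lemma fset2P (A : pattern) : #|` A| = 2%N ->
  exists a b, a != b /\ A = [fset a; b].
Proof.
move=> A2; have /fset0Pn [a aA] : A != fset0 by rewrite -cardfs_gt0 A2.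
have : #|` A `\ a| == 1%N by rewrite -(eqn_add2l 1) -[(1 + #|` _|)%N]/((true : nat) + _)%N -{1}aA -cardfsD1 A2.
move/cardfs1P => [b Eb]; exists a, b; split.
  by have := fset11 b; rewrite -Eb !inE eq_sym => /andP[].
by rewrite -(fsetD1K aA) Eb.
Qed.

Lemma step_move P Q : step P Q -> solitaire_move P Q.
Proof.
move=> [v [a [b [c [[Ta Tb Tc] [aP cP ac bP] ->]]]]].
have ab : a != b by apply: contraNneq bP => <-.
have cb : c != b by apply: contraNneq bP => <-.
have ET : translate v T = [fset a; b; c].
  apply/esym/eqP; rewrite eqEfcard card_translateT; apply/andP; split.
    by apply/fsubsetP => x; rewrite !inE in_translateT => /orP[/orP[]|] /eqP->.
  by rewrite cardfs3 // eq_sym.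
exists v, [fset b; c]; rewrite ET; split.
- have -> : P `&` [fset a; b; c] = [fset a; c].
    apply/fsetP => x; rewrite !inE; case: (eqVneq x a) => [->|_] /=; first by rewrite aP.
    case: (eqVneq x b) => [->|_] /=; first by rewrite (negPf bP) eq_sym (negPf cb).
    by case: (eqVneq x c) => [->|_] /=; rewrite ?cP ?andbF.
  by rewrite cardfs2 ac.
- by apply/fsubsetP => x; rewrite !inE => /orP[]->; rewrite ?orbT.
- by rewrite cardfs2 eq_sym cb.
- apply/fsetP => x; rewrite !inE.
  case: (eqVneq x b) => [->|_] /=; first by rewrite orbT.
  case: (eqVneq x c) => [->|_] /=; first by rewrite orbT cP eq_sym ac.
  by rewrite !orbF.
Qed.

(** A nontrivial [S] contains the empty cell [b] of the translate; its other cell is one of the two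
    tokens, which becomes the token that stays. *)
Lemma move_step P Q : solitaire_move P Q -> P = Q \/ step P Q.
Proof.
move=> [v [S [P2 ST S2 EQ]]].
have [a [c [ac EA]]] := fset2P P2.
have PT x : (x \in P) && intri (cellT v) x = (x == a) || (x == c).
  by have := congr1 (fun A : pattern => x \in A) EA; rewrite !inE in_translateT.
have [/eqP ES|NS] := boolP (S == [fset a; c]).
  left; apply/fsetP => x; rewrite EQ ES !inE in_translateT -PT.
  by case: (x \in P); case: (intri _ x).
right.
have [b bS bac] : exists2 b, b \in S & b \notin [fset a; c].
  apply/fsubsetPn; apply: contra NS => sub.
  by rewrite eqEfcard sub S2 cardfs2 ac.
have Tb : intri (cellT v) b by rewrite -in_translateT (fsubsetP ST).
have bP : b \notin P.
  by apply: contra bac => bP; rewrite !inE -PT bP.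
have Ta : (a \in P) && intri (cellT v) a by rewrite PT eqxx.
have Tc : (c \in P) && intri (cellT v) c by rewrite PT eqxx orbT.
move/andP: Ta => [aP Ta]; move/andP: Tc => [cP Tc].
have ab : a != b by apply: contraNneq bP => <-.
have cb : c != b by apply: contraNneq bP => <-.
have ET : translate v T = [fset a; b; c].
  apply/esym/eqP; rewrite eqEfcard card_translateT; apply/andP; split.
    by apply/fsubsetP => x; rewrite !inE in_translateT => /orP[/orP[]|] /eqP->.
  by rewrite cardfs3 // eq_sym.
have [b1 [b2 [b12 ES]]] := fset2P S2.
have inS x : (x \in S) = (x == b1) || (x == b2) by rewrite ES !inE.
have main x y : x != y -> x \in P -> y \in P -> intri (cellT v) x -> intri (cellT v) y ->
    translate v T = [fset x; b; y] -> S = [fset b; y] -> step P Q.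
  move=> xy xP yP Tx Ty ET' ES'; exists v, x, b, y; split=> //.
  rewrite EQ ES' ET'; apply/fsetP => z; rewrite !inE.
  case: (eqVneq z b) => [->|_] /=; first by rewrite orbT.
  case: (eqVneq z y) => [->|_] /=; first by rewrite orbT yP eq_sym xy.
  by rewrite !orbF.
have [d [db ES']] : exists d, d != b /\ S = [fset b; d].
  move: bS; rewrite inS => /orP[] /eqP Eb.
    by exists b2; rewrite Eb eq_sym b12 ES.
  by exists b1; rewrite Eb b12 ES fsetUC.
have : d \in translate v T by apply: (fsubsetP ST); rewrite ES' !inE eqxx orbT.
rewrite ET !inE (negPf db) orbF => /orP[] /eqP Ed; subst d.
  apply: (main c a) => //; first by rewrite eq_sym.
  by rewrite ET; apply/fsetP => z; rewrite !inE; case: (z == a); case: (z == b); case: (z == c).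
by apply: (main a c).
Qed.

(** The index only bounds the number of steps from above, since [reach_refl] accepts every [k]. *)
Inductive reach : nat -> pattern -> pattern -> Prop :=
| reach_refl k P : reach k P P
| reach_step k P Q Q' : step P Q -> reach k Q Q' -> reach k.+1 P Q'.

Lemma reach_trans k l P Q Q' : reach k P Q -> reach l Q Q' -> reach (k + l) P Q'.
Proof.
move=> H; elim: H l Q' => {k P Q} [k P|k P Q R PQ _ IH] l Q' H.
  by elim: H k => {l P Q'} [l P|l P Q Q' PQ _ IH] k; [constructor | rewrite addnS; apply: reach_step (IH _)].
by rewrite addSn; apply: reach_step (IH _ _ H).
Qed.

Lemma reach_leq k l P Q : (k <= l)%N -> reach k P Q -> reach l P Q.
Proof. by move=> /subnKC <- H; apply: reach_trans H (reach_refl _ _). Qed.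

Lemma reach1 P Q : step P Q -> reach 1 P Q.
Proof. by move=> H; apply: reach_step H (reach_refl _ _). Qed.

Lemma reach_sym k P Q : reach k P Q -> reach k Q P.
Proof.
elim=> {k P Q} [k P|k P Q Q' PQ _ IH]; first by constructor.
by rewrite -addn1; apply: reach_trans IH (reach1 (step_sym PQ)).
Qed.

Lemma reach_card k P Q : reach k P Q -> #|` Q| = #|` P|.
Proof. by elim=> {k P Q} // k P Q Q' /step_card <- _. Qed.

(** * Independence: the bound on tokens in a triangle *)

Definition tokens (P : pattern) (K : tri) : pattern := [fset c in P | intri K c].

Lemma in_tokens P K c : (c \in tokens P K) = (c \in P) && intri K c.
Proof. by rewrite !inE. Qed.

Lemma tokensS P Q K K' : {subset P <= Q} -> (forall c, intri K c -> intri K' c) ->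
  tokens P K `<=` tokens Q K'.
Proof.
move=> PQ KK; apply/fsubsetP => c; rewrite !in_tokens => /andP[/PQ-> /KK->] //.
Qed.

Definition indep (P : pattern) : Prop :=
  forall K, 0 <= side K -> #|` tokens P K|%:Z <= side K.

Lemma tri_closed K v a b c : intri (cellT v) a -> intri (cellT v) b ->
  intri (cellT v) c -> a != b -> intri K a -> intri K b -> intri K c.
Proof. by rewrite cell_eqE /intri /=; lia. Qed.

(** Seen from [b], the two other cells of a translate of [T] are shifted in a common direction, so
    both lie just beyond the same side of [K]; pushing this side out by one takes both in. *)
Lemma tri_enlarge K v a b c : intri (cellT v) a -> intri (cellT v) b ->
  intri (cellT v) c -> intri K b -> ~~ intri K a -> ~~ intri K c ->
  exists K', [/\ side K' = side K + 1, forall d, intri K d -> intri K' d,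
                 intri K' a & intri K' c].
Proof.
case: K => [[p q] r] Ta Tb Tc Kb Ka Kc.
have : [|| intri (p + 1, q, r) a && intri (p + 1, q, r) c,
           intri (p, q + 1, r) a && intri (p, q + 1, r) c |
           intri (p, q, r - 1) a && intri (p, q, r - 1) c].
  by move: Ta Tb Tc Ka Kb Kc; rewrite /intri /=; lia.
by case/or3P => /andP[]; [exists (p + 1, q, r)|exists (p, q + 1, r)|exists (p, q, r - 1)];
   split=> //; rewrite /side /intri /=; lia.
Qed.

(** The dangerous case brings [b] into [K] from a cell [a] outside. Then [c] is outside too, and the
    enlarged triangle holds [a], [c] and all tokens of [K], so [K] had room for one more. *)
Lemma indep_step P Q : step P Q -> indep P -> indep Q.
Proof.
move=> [v [a [b [c [[Ta Tb Tc] [aP cP ac bP] ->]]]]] iP K K0.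
have ab : a != b by apply: contraNneq bP => <-.
have cb : c != b by apply: contraNneq bP => <-.
have [bK|bK] := boolP (intri K b); last first.
  apply: le_trans (iP K K0); rewrite lez_nat fsubset_leq_card //.
  apply/fsubsetP => x; rewrite !in_tokens !inE => /andP[/orP[/eqP->|/andP[_ ->]]] //.
  by rewrite (negPf bK).
have EQ : tokens (b |` P `\ a) K = b |` (tokens P K `\ a).
  apply/fsetP => x; rewrite !in_tokens !inE.
  by case: (eqVneq x b) => [->|] //=; rewrite ?bK // andbA.
have nb : b \notin tokens P K `\ a by rewrite !inE (negPf bP) andbF.
have [aK|aK] := boolP (intri K a).
  rewrite EQ cardfsU1 nb; have := iP K K0.
  by rewrite (cardfsD1 a) in_tokens aP aK.
have cK : ~~ intri K c.
  by apply: contra aK => cK; apply: (tri_closed Tb Tc Ta); rewrite // eq_sym.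
have [K' [sK' KK aK' cK']] := tri_enlarge Ta Tb Tc bK aK cK.
have K'0 : 0 <= side K' by rewrite sK'; clear -K0; lia.
have := iP K' K'0; rewrite sK'.
have : (#|` tokens P K| + 2 <= #|` tokens P K'|)%N.
  have -> : (#|` tokens P K| + 2 = #|` a |` (c |` tokens P K)|)%N.
    by rewrite !cardfsU1 !inE (negPf aK) (negPf cK) (negPf ac) !andbF /= addnC.
  apply: fsubset_leq_card; apply/fsubsetP => x; rewrite !inE.
  move=> /or3P[/eqP->|/eqP->|/andP[-> /KK->]] //.
    by rewrite aP.
  by rewrite cP.
have : (#|` tokens (b |` P `\ a) K| <= #|` tokens P K| + 1)%N.
  by rewrite EQ cardfsU1 nb addnC leq_add2r fsubset_leq_card // fsubD1set.
by clear; lia.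
Qed.

Lemma indep_reach k P Q : reach k P Q -> indep P -> indep Q.
Proof. by elim=> // {}k P' Q' Q'' /indep_step H _ IH /H. Qed.

Lemma indep_sub P Q : {subset P <= Q} -> indep Q -> indep P.
Proof.
move=> PQ iQ K K0; apply: le_trans (iQ K K0).
by rewrite lez_nat fsubset_leq_card // tokensS.
Qed.

(** Closure under completing a translate of [T] from two of its cells: moves cannot leave such a
    set, and triangles are examples by [tri_closed]. *)
Definition fill_closed (S : cell -> Prop) : Prop :=
  forall v a b c, intri (cellT v) a -> intri (cellT v) b -> intri (cellT v) c ->
    a != b -> S a -> S b -> S c.

Lemma closed_step S P Q : fill_closed S -> step P Q ->
  (forall c, c \in P -> S c) -> forall c, c \in Q -> S c.
Proof.
move=> cS [v [a [b [c [[Ta Tb Tc] [aP cP ac bP] ->]]]]] PS x.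
rewrite !inE => /orP[/eqP->|/andP[_ /PS]] //.
by apply: (cS _ _ _ _ Ta Tc Tb ac); apply: PS.
Qed.

Lemma closed_reach k S P Q : fill_closed S -> reach k P Q ->
  (forall c, c \in P -> S c) -> forall c, c \in Q -> S c.
Proof. by move=> cS; elim=> // {}k P' Q' Q'' /(closed_step cS) H _ IH /H. Qed.

Lemma in_image_iota (f : nat -> cell) s c :
  reflect (exists2 i, (i < s)%N & c = f i) (c \in [fset f i | i in iota 0 s]).
Proof.
apply: (iffP (imfsetP _ _ _ _)) => [[i /=]|[i si ->]].
  by rewrite mem_iota => si ->; exists i.
by exists i => //=; rewrite mem_iota.
Qed.

(** * Rolling lines of tokens *)

Section Roll.
Variables (a b : nat -> cell) (s : nat) (R : pattern).
Hypothesis a_inj : injective a.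
Hypothesis b_inj : injective b.
Hypothesis ab : forall i j, a i <> b j.
Hypothesis abb : forall i, exists v,
  [/\ intri (cellT v) (a i), intri (cellT v) (b i) & intri (cellT v) (b i.+1)].
Hypothesis aR : forall i, (i < s)%N -> a i \notin R.
Hypothesis bR : forall i, (i <= s)%N -> b i \notin R.

(* The tokens [a i] with [l <= i < u] have already been rolled onto the line of the [b i]. *)
Let rolled l u c : Prop :=
  [\/ c \in R, exists i, [/\ (i < s)%N, ~~ (l <= i < u)%N & c = a i] |
      exists i, (l <= i <= u)%N /\ c = b i].

(** The interval first grows upwards: [a u] jumps to [b u.+1], supported by [b u], until [u = s]. It
    then grows downwards: [a l] jumps to [b l], supported by [b l.+1]. *)
Lemma reach_rolled l u P Q : (l <= u <= s)%N ->
  (forall c, c \in P <-> rolled l u c) -> (forall c, c \in Q <-> rolled 0 s c) ->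
  reach (s - u + l) P Q.
Proof.
move: {2}(s - u + l)%N (erefl (s - u + l)%N) => n.
elim: n l u P => [|n IH] l u P En lus HP HQ.
  have [-> ->] : l = 0%N /\ u = s by lia.
  suff -> : P = Q by constructor.
  have [l0 us] : l = 0%N /\ u = s by lia.
  move: HP; rewrite l0 us => HP.
  by apply/fsetP => c; apply/idP/idP => [/HP/HQ|/HQ/HP].
have bab i j : (b i == a j) = false by apply/eqP => /esym; apply: ab.
have [us|us] := ltnP u s.
  have aP : a u \in P by apply/HP; constructor 2; exists u; split; rewrite ?ltnn ?andbF.
  have bP : b u \in P by apply/HP; constructor 3; exists u; split=> //; lia.
  have b'P : b u.+1 \notin P.
    apply/negP => /HP [|[i [_ _ /esym/ab]]|[i [iu /b_inj E]]] //; last by lia.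
    by apply/negP; apply: bR; lia.
  have -> : (s - u + l = (s - u.+1 + l).+1)%N by lia.
  apply: (@reach_step _ _ (b u.+1 |` (P `\ a u))).
    have [v [h1 h2 h3]] := abb u.
    by exists v, (a u), (b u.+1), (b u); split=> //; split=> //; apply/eqP; apply: ab.
  apply: IH HQ; [lia|lia|] => c; rewrite !inE; split.
    case/orP => [/eqP->|/andP[/eqP cau /HP[cR|[i [is_ iu ci]]|[i [iu ci]]]]].
    - by constructor 3; exists u.+1; split=> //; lia.
    - by constructor 1.
    - constructor 2; exists i; split=> //.
      by have : i <> u by [move=> E; apply: cau; rewrite ci E]; lia.
    - by constructor 3; exists i; split=> //; lia.
  move=> [cR|[i [is_ iu ci]]|[i [iu ci]]].
  - apply/orP; right; apply/andP; split; last by apply/HP; constructor 1.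
    by apply/eqP => E; move: (aR us); rewrite -E cR.
  - apply/orP; right; apply/andP; split; last first.
      by apply/HP; constructor 2; exists i; split=> //; lia.
    by apply/eqP; rewrite ci => /a_inj; lia.
  - have [E|iu'] := eqVneq i u.+1; first by rewrite ci E eqxx.
    apply/orP; right; rewrite ci bab /=; apply/HP; constructor 3.
    by exists i; split=> //; lia.
have l0 : (0 < l)%N by lia.
case: l l0 En lus HP => // l _ En lus HP.
have aP : a l \in P.
  by apply/HP; constructor 2; exists l; split; rewrite ?ltnn //; lia.
have bP : b l.+1 \in P by apply/HP; constructor 3; exists l.+1; split=> //; lia.
have b'P : b l \notin P.
  apply/negP => /HP [|[i [_ _ /esym/ab]]|[i [iu /b_inj E]]] //; last by lia.
  by apply/negP; apply: bR; lia.
rewrite addnS; apply: (@reach_step _ _ (b l |` (P `\ a l))).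
  have [v [h1 h2 h3]] := abb l.
  by exists v, (a l), (b l), (b l.+1); split=> //; split=> //; apply/eqP; apply: ab.
apply: IH HQ; [lia|lia|] => c; rewrite !inE; split.
  case/orP => [/eqP->|/andP[/eqP cau /HP[cR|[i [is_ iu ci]]|[i [iu ci]]]]].
  - by constructor 3; exists l; split=> //; lia.
  - by constructor 1.
  - constructor 2; exists i; split=> //.
    by have : i <> l by [move=> E; apply: cau; rewrite ci E]; lia.
  - by constructor 3; exists i; split=> //; lia.
move=> [cR|[i [is_ iu ci]]|[i [iu ci]]].
- apply/orP; right; apply/andP; split; last by apply/HP; constructor 1.
  by apply/eqP => E; have /negP := aR (i := l) ltac:(lia); apply; rewrite -E.
- apply/orP; right; apply/andP; split; last first.
    by apply/HP; constructor 2; exists i; split=> //; lia.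
  by apply/eqP; rewrite ci => /a_inj; lia.
- have [E|iu'] := eqVneq i l; first by rewrite ci E eqxx.
  apply/orP; right; rewrite ci bab /=; apply/HP; constructor 3.
  by exists i; split=> //; lia.
Qed.

Lemma reach_roll j : (j <= s)%N ->
  reach s (R `|` [fset a i | i in iota 0 s] `|` [fset b j])
          (R `|` [fset b i | i in iota 0 s.+1]).
Proof.
move=> js; apply: (@reach_leq (s - j + j)); first by lia.
apply: reach_rolled => [|c|c]; first by lia.
- rewrite !inE; split.
    case/orP => [/orP[cR|/in_image_iota[i]]|/eqP->].
    + by constructor 1.
    + by move=> is_ ->; constructor 2; exists i; split=> //; lia.
    + by constructor 3; exists j; split=> //; lia.
  case=> [->|[i [is_ _ ->]]|[i [ij ->]]] //.
    by apply/orP; left; apply/orP; right; apply/in_image_iota; exists i.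
  by have -> : i = j by [lia]; rewrite eqxx orbT.
- rewrite !inE; split.
    case/orP => [cR|/in_image_iota[i]]; first by constructor 1.
    by move=> is_ ->; constructor 3; exists i; split=> //; lia.
  case=> [->|[i [is_]]|[i [ij ->]]] //; first by lia.
  by apply/orP; right; apply/in_image_iota; exists i => //; lia.
Qed.
End Roll.

(** The line [g k] rolls onto the single token at position [j k] of the line [g k.+1] and becomes
    one cell longer. Each of the [m] rolls takes at most [s + m] steps. *)
Lemma reach_rolls (g : nat -> nat -> cell) (j : nat -> nat) (s m : nat) (R : pattern) :
  (forall k i k' i', g k i = g k' i' -> k = k' /\ i = i') ->
  (forall k i, exists v, [/\ intri (cellT v) (g k i), intri (cellT v) (g k.+1 i)
                           & intri (cellT v) (g k.+1 i.+1)]) ->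
  (forall k, (k < m)%N -> (j k <= s + k)%N) ->
  (forall k i, (k <= m)%N -> (i < s + k)%N -> g k i \notin R) ->
  reach (m * (s + m))
    (R `|` [fset g 0%N i | i in iota 0 s] `|` [fset g k.+1 (j k) | k in iota 0 m])
    (R `|` [fset g m i | i in iota 0 (s + m)]).
Proof.
move=> g_inj g_tri; elim: m R => [|m IH] R js gR.
  rewrite mul0n addn0.
  have -> : [fset g k.+1 (j k) | k in iota 0 0] = fset0 :> pattern.
    by apply/fsetP => c; rewrite !inE; apply/negP => /in_image_iota[].
  by rewrite fsetU0; constructor.
have jm : (j m <= s + m)%N by apply: js.
set d := g m.+1 (j m).
(* During the first [m] rolls the token [d] of the last line counts as part of the rest. *)
have H1 : reach (m * (s + m))
    ((d |` R) `|` [fset g 0%N i | i in iota 0 s] `|` [fset g k.+1 (j k) | k in iota 0 m])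
    ((d |` R) `|` [fset g m i | i in iota 0 (s + m)]).
  apply: IH => [k km|k i km ik]; first by apply: js; lia.
  rewrite !inE; apply/negP => /orP[/eqP/g_inj|]; first by lia.
  by apply/negP/gR; lia.
have H2 : reach (s + m)
   (R `|` [fset g m i | i in iota 0 (s + m)] `|` [fset d])
   (R `|` [fset g m.+1 i | i in iota 0 (s + m).+1]).
  apply: reach_roll => //.
  - by move=> i i' /g_inj [].
  - by move=> i i' /g_inj [].
  - by move=> i i' /g_inj; lia.
  - by move=> i im; apply: gR; lia.
  - by move=> i im; apply: gR; lia.
have -> : R `|` [fset g 0%N i | i in iota 0 s] `|` [fset g k.+1 (j k) | k in iota 0 m.+1] =
  (d |` R) `|` [fset g 0%N i | i in iota 0 s] `|` [fset g k.+1 (j k) | k in iota 0 m].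
  have -> : [fset g k.+1 (j k) | k in iota 0 m.+1] =
      d |` [fset g k.+1 (j k) | k in iota 0 m] :> pattern.
    apply/fsetP => c; rewrite !inE; apply/in_image_iota/orP => [[k]|[/eqP->|/in_image_iota[k]]].
    - move=> km ->; have [->|nk] := eqVneq k m; first by left.
      by right; apply/in_image_iota; exists k => //; lia.
    - by exists m.
    - by move=> km ->; exists k => //; lia.
  by rewrite [d |` R]fsetUC -!fsetUA; congr fsetU; apply: fsetUCA.
rewrite addnS; apply: reach_leq (reach_trans H1 _); last first.
  have -> : d |` R `|` [fset g m i | i in iota 0 (s + m)] =
    R `|` [fset g m i | i in iota 0 (s + m)] `|` [fset d] by rewrite -fsetUA fsetUC.
  exact: H2.
nia.
Qed.

(** * Merging triangles *)

(* Because of [absz], the three sides are meaningful only when [0 <= side K]. *)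
Definition top_row (K : tri) : pattern :=
  [fset ((K.2 - K.1.2 + i%:Z, K.1.2) : cell) | i in iota 0 (absz (side K)%R)].

Definition right_col (K : tri) : pattern :=
  [fset ((K.1.1, K.1.2 - i%:Z) : cell) | i in iota 0 (absz (side K)%R)].

Definition low_diag (K : tri) : pattern :=
  [fset ((K.2 - K.1.2 + i%:Z, K.1.2 - i%:Z) : cell) | i in iota 0 (absz (side K)%R)].

Lemma in_top_row K c : 0 <= side K ->
  (c \in top_row K) = (c.2 == K.1.2) && intri K c.
Proof.
case: K c => [[p q] r] [x y]; rewrite /side /intri /= => K0.
apply/in_image_iota/idP => [[i si [-> ->]]|h]; first by rewrite /side /= in si; lia.
by exists (absz (x - (r - q))%R); rewrite /side /=; [lia|apply: cell_eqP => /=; lia].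
Qed.

Lemma in_right_col K c : 0 <= side K ->
  (c \in right_col K) = (c.1 == K.1.1) && intri K c.
Proof.
case: K c => [[p q] r] [x y]; rewrite /side /intri /= => K0.
apply/in_image_iota/idP => [[i si [-> ->]]|h]; first by rewrite /side /= in si; lia.
by exists (absz (q - y)%R); rewrite /side /=; [lia|apply: cell_eqP => /=; lia].
Qed.

Lemma in_low_diag K c : 0 <= side K ->
  (c \in low_diag K) = (c.1 + c.2 == K.2) && intri K c.
Proof.
case: K c => [[p q] r] [x y]; rewrite /side /intri /= => K0.
apply/in_image_iota/idP => [[i si [-> ->]]|h]; first by rewrite /side /= in si; lia.
by exists (absz (q - y)%R); rewrite /side /=; [lia|apply: cell_eqP => /=; lia].
Qed.

Lemma card_row K : 0 <= side K -> #|` top_row K|%:Z = side K.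
Proof.
move=> K0; rewrite card_imfset /=; last by move=> i j [/addrI [->]].
by rewrite (undup_id (iota_uniq _ _)) size_iota; lia.
Qed.

(** The columns are swept from the top left corner to the right. Each new column meets one token of
    the top row, at its upper end, whence the constant position [0] and the initial line of one
    cell. *)
Lemma reach_row_col K R n : 1 <= side K -> ((absz (side K)%R) <= n)%N ->
  (forall c, c \in R -> ~~ intri K c) -> reach (n ^ 2) (R `|` top_row K) (R `|` right_col K).
Proof.
case: K => [[p q] r]; rewrite /side /= => K1 Kn RK.
have K0 : 0 <= side (p, q, r) by rewrite /side /=; lia.
pose g (k i : nat) : cell := (r - q + k%:Z, q - i%:Z).
have := @reach_rolls g (fun=> 0%N) 1 (absz (p + q - r)%R) R.
have -> : R `|` [fset g 0%N i | i in iota 0 1] `|` [fset g k.+1 0%N | k in iota 0 (absz (p + q - r)%R)] =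
    R `|` top_row (p, q, r).
  rewrite -fsetUA; congr (_ `|` _); apply/fsetP => -[x y].
  rewrite in_fsetU (in_top_row _ K0) /intri.
  apply/orP/idP => [[/in_image_iota[i ? [-> ->]]|/in_image_iota[i ? [-> ->]]]|h].
  - by rewrite /=; lia.
  - by rewrite /=; lia.
  rewrite /= in h.
  have [E|E] := eqVneq x (r - q); [left|right]; apply/in_image_iota.
    by exists 0%N => //; apply: cell_eqP => /=; lia.
  by exists (absz (x - (r - q) - 1)%R); [lia|apply: cell_eqP => /=; lia].
have -> : [fset g (absz (p + q - r)%R) i | i in iota 0 (1 + (absz (p + q - r)%R))] = right_col (p, q, r) :> pattern.
  apply/fsetP => -[x y]; rewrite (in_right_col _ K0) /intri.
  apply/in_image_iota/idP => [[i ? [-> ->]]|h]; first by rewrite /=; lia.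
  rewrite /= in h.
  by exists (absz (q - y)%R); [lia|apply: cell_eqP => /=; lia].
move=> H; apply: reach_leq (H _ _ _ _) => //.
- by rewrite -mulnn; nia.
- by move=> k i k' i' [] *; lia.
- by move=> k i; exists (r - q + k%:Z, q - i%:Z - 1); split; rewrite /intri /g /=; lia.
- move=> k i km ik; by apply/negP => /RK; rewrite /intri /g /=; lia.
Qed.

(** The same sweep with diagonals, starting at the top right corner. *)
Lemma reach_row_diag K R n : 1 <= side K -> ((absz (side K)%R) <= n)%N ->
  (forall c, c \in R -> ~~ intri K c) -> reach (n ^ 2) (R `|` top_row K) (R `|` low_diag K).
Proof.
case: K => [[p q] r]; rewrite /side /= => K1 Kn RK.
have K0 : 0 <= side (p, q, r) by rewrite /side /=; lia.
pose g (k i : nat) : cell := (p - k%:Z + i%:Z, q - i%:Z).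
have := @reach_rolls g (fun=> 0%N) 1 (absz (p + q - r)%R) R.
have -> : R `|` [fset g 0%N i | i in iota 0 1] `|` [fset g k.+1 0%N | k in iota 0 (absz (p + q - r)%R)] =
    R `|` top_row (p, q, r).
  rewrite -fsetUA; congr (_ `|` _); apply/fsetP => -[x y].
  rewrite in_fsetU (in_top_row _ K0) /intri.
  apply/orP/idP => [[/in_image_iota[i ? [-> ->]]|/in_image_iota[i ? [-> ->]]]|h].
  - by rewrite /=; lia.
  - by rewrite /=; lia.
  rewrite /= in h.
  have [E|E] := eqVneq x p; [left|right]; apply/in_image_iota.
    by exists 0%N => //; apply: cell_eqP => /=; lia.
  by exists (absz (p - x - 1)%R); [lia|apply: cell_eqP => /=; lia].
have -> : [fset g (absz (p + q - r)%R) i | i in iota 0 (1 + (absz (p + q - r)%R))] = low_diag (p, q, r) :> pattern.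
  apply/fsetP => -[x y]; rewrite (in_low_diag _ K0) /intri.
  apply/in_image_iota/idP => [[i ? [-> ->]]|h]; first by rewrite /=; lia.
  rewrite /= in h.
  by exists (absz (q - y)%R); [lia|apply: cell_eqP => /=; lia].
move=> H; apply: reach_leq (H _ _ _ _) => //.
- by rewrite -mulnn; nia.
- by move=> k i k' i' [] *; lia.
- by move=> k i; exists (p - k%:Z + i%:Z - 1, q - i%:Z - 1); split; rewrite /intri /g /=; lia.
- move=> k i km ik; by apply/negP => /RK; rewrite /intri /g /=; lia.
Qed.

Section MergeCorner.
Variables (p1 q1 r1 p2 q2 r2 : int) (R : pattern) (n : nat).
Let K1 : tri := (p1, q1, r1).
Let K2 : tri := (p2, q2, r2).
Hypothesis K1_gt0 : 1 <= side K1.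
Hypothesis K2_gt0 : 1 <= side K2.
Hypothesis le_n : ((absz (side K1)%R) + (absz (side K2)%R) <= n)%N.

(** The low diagonal of [K2] passes just beyond the top right corner of [K1]. Rolled towards [K1],
    it meets one token of the top row of [K1] on each diagonal, at position [q2 - q1]. *)
Lemma reach_merge_r : p1 <= p2 -> q1 <= q2 -> r2 = p1 + q1 + 1 ->
  (forall c, c \in R -> ~~ intri (p2, q2, r1) c) ->
  reach (3 * n ^ 2) (R `|` top_row K1 `|` top_row K2) (R `|` top_row (p2, q2, r1)).
Proof.
move: K1_gt0 K2_gt0 le_n; rewrite /side /= => s1 s2 sn p12 q12 Er RE.
have H1 : reach (n ^ 2) (R `|` top_row K1 `|` top_row K2) (R `|` top_row K1 `|` low_diag K2).
  apply: reach_row_diag; rewrite /side /=; [lia|lia|] => -[x y].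
  by rewrite !inE in_top_row /side /= => [/orP[/RE|]|]; rewrite /intri /=; lia.
have H3 : reach (n ^ 2) (R `|` low_diag (p2, q2, r1)) (R `|` top_row (p2, q2, r1)).
  by apply/reach_sym/reach_row_diag => //; rewrite /side /=; lia.
suff H2 : reach (n ^ 2) (R `|` top_row K1 `|` low_diag K2) (R `|` low_diag (p2, q2, r1)).
  by apply: reach_leq (reach_trans (reach_trans H1 H2) H3); lia.
pose g (k i : nat) : cell := (r2 - q2 - k%:Z + i%:Z, q2 - i%:Z).
have := @reach_rolls g (fun=> (absz (q2 - q1)%R)) (absz (side K2)%R) (absz (side K1)%R) R.
have -> : R `|` [fset g 0%N i | i in iota 0 (absz (side K2)%R)] `|`
    [fset g k.+1 (absz (q2 - q1)%R) | k in iota 0 (absz (side K1)%R)] = R `|` top_row K1 `|` low_diag K2.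
  rewrite -!fsetUA; congr (_ `|` _); rewrite fsetUC; congr (_ `|` _); apply/fsetP => -[x y].
    rewrite in_top_row /side /intri /=; last by lia.
    apply/in_image_iota/idP => [[i ? [-> ->]]|h]; first by lia.
    by exists (absz (p1 - x)%R); [lia|apply: cell_eqP => /=; lia].
  rewrite in_low_diag /side /intri /=; last by lia.
  apply/in_image_iota/idP => [[i ? [-> ->]]|h]; first by lia.
  by exists (absz (q2 - y)%R); [lia|apply: cell_eqP => /=; lia].
have -> : [fset g (absz (side K1)%R) i | i in iota 0 ((absz (side K2)%R) + (absz (side K1)%R))] =
    low_diag (p2, q2, r1) :> pattern.
  apply/fsetP => -[x y]; rewrite in_low_diag /side /intri /=; last by lia.
  apply/in_image_iota/idP => [[i ? [-> ->]]|h]; first by lia.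
  by exists (absz (q2 - y)%R); [lia|apply: cell_eqP => /=; lia].
move=> H; apply: reach_leq (H _ _ _ _) => //; rewrite /side /=.
- by rewrite -mulnn; nia.
- by move=> k i k' i' [] *; lia.
- by move=> k i; exists (r2 - q2 - k%:Z + i%:Z - 1, q2 - i%:Z - 1); split; rewrite /intri /g /=; lia.
- by lia.
- move=> k i km ik; by apply/negP => /RE; rewrite /intri /g /=; lia.
Qed.

(** The lowest cell of [K1] is one row above the top row of [K2]. Once the tokens of [K1] form its
    right column, the top row of [K2] rises and meets one of them in each row. *)
Lemma reach_merge_q : p1 <= p2 -> r2 <= r1 -> q2 = r1 - p1 - 1 ->
  (forall c, c \in R -> ~~ intri (p2, q1, r2) c) ->
  reach (3 * n ^ 2) (R `|` top_row K1 `|` top_row K2) (R `|` top_row (p2, q1, r2)).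
Proof.
move: K1_gt0 K2_gt0 le_n; rewrite /side /= => s1 s2 sn p12 r12 Eq RE.
have H1 : reach (n ^ 2) (R `|` top_row K1 `|` top_row K2) (R `|` right_col K1 `|` top_row K2).
  rewrite ![R `|` _ `|` top_row K2]fsetUAC.
  apply: reach_row_col; rewrite /side /=; [lia|lia|] => -[x y].
  by rewrite !inE in_top_row /side /= => [/orP[/RE|]|]; rewrite /intri /=; lia.
suff H2 : reach (n ^ 2) (R `|` right_col K1 `|` top_row K2) (R `|` top_row (p2, q1, r2)).
  by apply: reach_leq (reach_trans H1 H2); lia.
pose g (k i : nat) : cell := (r2 - q2 - k%:Z + i%:Z, q2 + k%:Z).
have := @reach_rolls g (fun k => (absz (p1 - (r2 - q2) + k%:Z + 1)%R)) (absz (side K2)%R) (absz (side K1)%R) R.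
have -> : R `|` [fset g 0%N i | i in iota 0 (absz (side K2)%R)] `|`
    [fset g k.+1 (absz (p1 - (r2 - q2) + k%:Z + 1)%R) | k in iota 0 (absz (side K1)%R)] =
    R `|` right_col K1 `|` top_row K2.
  rewrite -!fsetUA; congr (_ `|` _); rewrite fsetUC; congr (_ `|` _); apply/fsetP => -[x y].
    rewrite in_right_col /side /intri /=; last by lia.
    apply/in_image_iota/idP => [[i ? [-> ->]]|h]; first by lia.
    by exists (absz (y - q2 - 1)%R); [lia|apply: cell_eqP => /=; lia].
  rewrite in_top_row /side /intri /=; last by lia.
  apply/in_image_iota/idP => [[i ? [-> ->]]|h]; first by lia.
  by exists (absz (x - (r2 - q2))%R); [lia|apply: cell_eqP => /=; lia].
have -> : [fset g (absz (side K1)%R) i | i in iota 0 ((absz (side K2)%R) + (absz (side K1)%R))] =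
    top_row (p2, q1, r2) :> pattern.
  apply/fsetP => -[x y]; rewrite in_top_row /side /intri /=; last by lia.
  apply/in_image_iota/idP => [[i ? [-> ->]]|h]; first by lia.
  by exists (absz (x - (r2 - q1))%R); [lia|apply: cell_eqP => /=; lia].
move=> H; apply: reach_leq (H _ _ _ _) => //; rewrite /side /=.
- by rewrite -mulnn; nia.
- by move=> k i k' i' [] *; lia.
- by move=> k i; exists (r2 - q2 - k%:Z + i%:Z - 1, q2 + k%:Z); split; rewrite /intri /g /=; lia.
- by lia.
- move=> k i km ik; by apply/negP => /RE; rewrite /intri /g /=; lia.
Qed.

(** The top left corner of [K1] is one column beyond the right column of [K2], which moves to the
    right and meets one token of the top row of [K1] in each column. *)
Lemma reach_merge_p : q1 <= q2 -> r2 <= r1 -> p2 = r1 - q1 - 1 ->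
  (forall c, c \in R -> ~~ intri (p1, q2, r2) c) ->
  reach (3 * n ^ 2) (R `|` top_row K1 `|` top_row K2) (R `|` top_row (p1, q2, r2)).
Proof.
move: K1_gt0 K2_gt0 le_n; rewrite /side /= => s1 s2 sn q12 r12 Ep RE.
have H1 : reach (n ^ 2) (R `|` top_row K1 `|` top_row K2) (R `|` top_row K1 `|` right_col K2).
  apply: reach_row_col; rewrite /side /=; [lia|lia|] => -[x y].
  by rewrite !inE in_top_row /side /= => [/orP[/RE|]|]; rewrite /intri /=; lia.
have H3 : reach (n ^ 2) (R `|` right_col (p1, q2, r2)) (R `|` top_row (p1, q2, r2)).
  by apply/reach_sym/reach_row_col => //; rewrite /side /=; lia.
suff H2 : reach (n ^ 2) (R `|` top_row K1 `|` right_col K2) (R `|` right_col (p1, q2, r2)).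
  by apply: reach_leq (reach_trans (reach_trans H1 H2) H3); lia.
pose g (k i : nat) : cell := (p2 + k%:Z, q2 - i%:Z).
have := @reach_rolls g (fun=> (absz (q2 - q1)%R)) (absz (side K2)%R) (absz (side K1)%R) R.
have -> : R `|` [fset g 0%N i | i in iota 0 (absz (side K2)%R)] `|`
    [fset g k.+1 (absz (q2 - q1)%R) | k in iota 0 (absz (side K1)%R)] = R `|` top_row K1 `|` right_col K2.
  rewrite -!fsetUA; congr (_ `|` _); rewrite fsetUC; congr (_ `|` _); apply/fsetP => -[x y].
    rewrite in_top_row /side /intri /=; last by lia.
    apply/in_image_iota/idP => [[i ? [-> ->]]|h]; first by lia.
    by exists (absz (x - p2 - 1)%R); [lia|apply: cell_eqP => /=; lia].
  rewrite in_right_col /side /intri /=; last by lia.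
  apply/in_image_iota/idP => [[i ? [-> ->]]|h]; first by lia.
  by exists (absz (q2 - y)%R); [lia|apply: cell_eqP => /=; lia].
have -> : [fset g (absz (side K1)%R) i | i in iota 0 ((absz (side K2)%R) + (absz (side K1)%R))] =
    right_col (p1, q2, r2) :> pattern.
  apply/fsetP => -[x y]; rewrite in_right_col /side /intri /=; last by lia.
  apply/in_image_iota/idP => [[i ? [-> ->]]|h]; first by lia.
  by exists (absz (q2 - y)%R); [lia|apply: cell_eqP => /=; lia].
move=> H; apply: reach_leq (H _ _ _ _) => //; rewrite /side /=.
- by rewrite -mulnn; nia.
- by move=> k i k' i' [] *; lia.
- by move=> k i; exists (p2 + k%:Z, q2 - i%:Z - 1); split; rewrite /intri /g /=; lia.
- by lia.
- move=> k i km ik; by apply/negP => /RE; rewrite /intri /g /=; lia.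
Qed.
End MergeCorner.

(** * Hulls and intersections of triangles *)

Definition hull (K1 K2 : tri) : tri :=
  (Num.max K1.1.1 K2.1.1, Num.max K1.1.2 K2.1.2, Num.min K1.2 K2.2).

Definition meet (K1 K2 : tri) : tri :=
  (Num.min K1.1.1 K2.1.1, Num.min K1.1.2 K2.1.2, Num.max K1.2 K2.2).

Lemma side_hull_meet K1 K2 : side (hull K1 K2) + side (meet K1 K2) = side K1 + side K2.
Proof. by rewrite /side /=; lia. Qed.

(** Of the three comparisons between the bounds of the triangles two go the same way, so up to
    exchange [K2] reaches at least as far in two directions. Each pair of directions is one of the
    three corner merges. *)
Lemma reach_merge K1 K2 R n : 1 <= side K1 -> 1 <= side K2 -> side (meet K1 K2) = 0 ->
  ((absz (side K1)%R) + (absz (side K2)%R) <= n)%N ->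
  (forall c, c \in R -> ~~ intri (hull K1 K2) c) ->
  reach (3 * n ^ 2) (R `|` top_row K1 `|` top_row K2) (R `|` top_row (hull K1 K2)).
Proof.
suff main J1 J2 : 1 <= side J1 -> 1 <= side J2 -> side (meet J1 J2) = 0 ->
    ((absz (side J1)%R) + (absz (side J2)%R) <= n)%N -> (forall c, c \in R -> ~~ intri (hull J1 J2) c) ->
    [|| (J1.1.1 <= J2.1.1) && (J1.1.2 <= J2.1.2),
        (J1.1.1 <= J2.1.1) && (J2.2 <= J1.2) | (J1.1.2 <= J2.1.2) && (J2.2 <= J1.2)] ->
    reach (3 * n ^ 2) (R `|` top_row J1 `|` top_row J2) (R `|` top_row (hull J1 J2)).
  move=> s1 s2 s0 sn RE.
  have [h|h] := boolP [|| (K1.1.1 <= K2.1.1) && (K1.1.2 <= K2.1.2),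
        (K1.1.1 <= K2.1.1) && (K2.2 <= K1.2) | (K1.1.2 <= K2.1.2) && (K2.2 <= K1.2)].
    by apply: main.
  have E : hull K1 K2 = hull K2 K1.
    by rewrite /hull maxC [Num.max K2.1.2 _]maxC [Num.min K2.2 _]minC.
  rewrite E fsetUAC; apply: main => //.
  - by move: s0; rewrite /meet minC [Num.min K1.1.2 _]minC [Num.max K1.2 _]maxC.
  - by rewrite addnC.
  - by rewrite -E.
  - by clear -h; lia.
case: J1 J2 => [[p1 q1] r1] [[p2 q2] r2] s1 s2.
rewrite /hull /meet {1}/side /= => s0 sn RE; move: s1 s2; rewrite /side /= => s1 s2.
case/or3P => /andP[h1 h2].
- have -> : (Num.max p1 p2, Num.max q1 q2, Num.min r1 r2) = (p2, q2, r1).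
    by congr (_, _, _); lia.
  apply: reach_merge_r => //; first by lia.
  by move=> c /RE; rewrite /intri /=; lia.
- have -> : (Num.max p1 p2, Num.max q1 q2, Num.min r1 r2) = (p2, q1, r2).
    by congr (_, _, _); lia.
  apply: reach_merge_q => //; first by lia.
  by move=> c /RE; rewrite /intri /=; lia.
- have -> : (Num.max p1 p2, Num.max q1 q2, Num.min r1 r2) = (p1, q2, r2).
    by congr (_, _, _); lia.
  apply: reach_merge_p => //; first by lia.
  by move=> c /RE; rewrite /intri /=; lia.
Qed.

(* [side (meet K1 K2)] is negative for distant triangles and [0] for disjoint ones that touch. *)
Definition apart (K1 K2 : tri) : bool := side (meet K1 K2) < 0.

Lemma apart_sym : symmetric apart.
Proof. by move=> K1 K2; rewrite /apart /side /=; lia. Qed.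

(** * Families of triangles with tokens on their top rows *)

Definition rows (Ks : seq tri) : pattern := \big[fsetU/fset0]_(K <- Ks) top_row K.

Definition total (Ks : seq tri) : int := \sum_(K <- Ks) side K.

Definition nonempty (K : tri) : bool := 1 <= side K.

Lemma rowsE K Ks : rows (K :: Ks) = top_row K `|` rows Ks.
Proof. by rewrite /rows big_cons. Qed.

Lemma totalE K Ks : total (K :: Ks) = side K + total Ks.
Proof. by rewrite /total big_cons. Qed.

Lemma in_rows Ks c : reflect (exists2 K, K \in Ks & c \in top_row K) (c \in rows Ks).
Proof.
apply: (iffP idP) => [|[K]]; elim: Ks => [|K1 Ks IH] //.
- by rewrite /rows big_nil inE.
- rewrite rowsE in_fsetU => /orP[cK|/IH[J JK cJ]]; first by exists K1; rewrite ?mem_head.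
  by exists J => //; rewrite in_cons JK orbT.
- rewrite in_cons rowsE in_fsetU => /orP[/eqP->|KK] cK; first by rewrite cK.
  by rewrite IH ?orbT.
Qed.

Lemma total_ge0 Ks : all nonempty Ks -> 0 <= total Ks.
Proof.
elim: Ks => [|K Ks IH] /=; first by rewrite /total big_nil.
by rewrite totalE /nonempty => /andP[? /IH]; lia.
Qed.

Lemma card_rows Ks : all nonempty Ks -> #|` rows Ks|%:Z <= total Ks.
Proof.
elim: Ks => [|K Ks IH]; first by rewrite /rows /total !big_nil cardfs0.
move=> /andP[K1 /IH h]; rewrite rowsE totalE.
have := card_row (K := K) ltac:(move: K1; rewrite /nonempty; lia).
have : (#|` top_row K `|` rows Ks| <= #|` top_row K| + #|` rows Ks|)%N.
  by rewrite -cardfsUI leq_addr.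
by move: h; clear; lia.
Qed.

Lemma pairwise_mem (T : eqType) (r : rel T) (s : seq T) x y : symmetric r ->
  pairwise r s -> x \in s -> y \in s -> x != y -> r x y.
Proof.
move=> r_sym; elim: s => //= z s IH /andP[/allP rz rs].
rewrite !in_cons => /orP[/eqP->|xs] /orP[/eqP->|ys] xy.
- by rewrite eqxx in xy.
- exact: rz.
- by rewrite r_sym; apply: rz.
- exact: IH.
Qed.

Lemma touching_meet K1 K2 v a b : intri (cellT v) a -> intri (cellT v) b ->
  intri K1 a -> intri K2 b -> ~~ apart K1 K2.
Proof. by rewrite /apart /side /intri /=; lia. Qed.

(** By [touching_meet] two cells of a common translate of [T] cannot lie in different members of the
    family, and each single member is closed. *)
Lemma closed_apart Ks : pairwise apart Ks ->
  fill_closed (fun c => exists2 K, K \in Ks & intri K c).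
Proof.
move=> sep v a b c Ta Tb Tc ab [K1 K1s K1a] [K2 K2s K2b].
have [E|N] := eqVneq K1 K2.
  by exists K1 => //; apply: (tri_closed Ta Tb Tc ab K1a); rewrite E.
by have := pairwise_mem apart_sym sep K1s K2s N; rewrite (negPf (touching_meet Ta Tb K1a K2b)).
Qed.

Lemma apart_or_touching Ks : pairwise apart Ks \/
  exists K1 K2 Ks', perm_eq Ks [:: K1, K2 & Ks'] /\ ~~ apart K1 K2.
Proof.
elim: Ks => [|K Ks [sep|[K1 [K2 [Ks' [Kp t]]]]]]; first by left.
  have [h|/allPn[K2 K2s t]] := boolP (all (apart K) Ks); first by left; rewrite /= h.
  by right; exists K, K2, (rem K2 Ks); rewrite perm_cons perm_to_rem.
right; exists K1, K2, (K :: Ks'); split=> //.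
rewrite -(perm_cons K) in Kp; apply: perm_trans Kp _.
exact/permPl/(perm_catCA [:: K] [:: K1; K2]).
Qed.

Lemma top_row_intri K c : nonempty K -> c \in top_row K -> intri K c.
Proof.
by rewrite /nonempty => K1; rewrite in_top_row => [/andP[]|] //; lia.
Qed.

Lemma intri_hull K1 K2 c : intri K1 c || intri K2 c -> intri (hull K1 K2) c.
Proof. by rewrite /intri /=; lia. Qed.

(** Equality in the count makes the rows disjoint. The hull holds both rows, so independence bounds
    the side of the meet by zero, and touching makes it zero. The hull is then saturated, so the
    other rows avoid it, as the merge requires. *)
Lemma reach_merge_rows K1 K2 Ks : all nonempty [:: K1, K2 & Ks] ->
  indep (rows [:: K1, K2 & Ks]) -> #|` rows [:: K1, K2 & Ks]|%:Z = total [:: K1, K2 & Ks] ->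
  ~~ apart K1 K2 ->
  side (hull K1 K2) = side K1 + side K2 /\
  reach (3 * #|` rows [:: K1, K2 & Ks]| ^ 2) (rows [:: K1, K2 & Ks]) (rows (hull K1 K2 :: Ks)).
Proof.
move=> /and3P[N1 N2 Ns]; set P := rows _ => iP cP touch.
have EP : P = (top_row K1 `|` top_row K2) `|` rows Ks by rewrite /P !rowsE fsetUA.
set A := top_row K1 `|` top_row K2 in EP.
have h1 := card_row (K := K1) ltac:(move: N1; rewrite /nonempty; clear; lia).
have h2 := card_row (K := K2) ltac:(move: N2; rewrite /nonempty; clear; lia).
have hs := card_rows Ns.
have hA : (#|` A| + #|` top_row K1 `&` top_row K2| = #|` top_row K1| + #|` top_row K2|)%N by exact: cardfsUI.
have hP : (#|` P| + #|` A `&` rows Ks| = #|` A| + #|` rows Ks|)%N by rewrite EP; exact: cardfsUI.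
have hH : (#|` A| <= #|` tokens P (hull K1 K2)|)%N.
  apply: fsubset_leq_card; apply/fsubsetP => c cA; rewrite in_tokens EP in_fsetU cA /=.
  apply: intri_hull; move: cA; rewrite in_fsetU.
  by move=> /orP[/(top_row_intri N1)|/(top_row_intri N2)] ->; rewrite ?orbT.
have sH := side_hull_meet K1 K2.
have T0 := total_ge0 Ns.
rewrite !totalE in cP.
have sH0 : 0 <= side (hull K1 K2).
  by move: N1 N2; rewrite /nonempty /side /=; clear; lia.
have iH := iP _ sH0.
have m0 : side (meet K1 K2) = 0.
  move: touch; rewrite /apart -leNgt => touch.
  by clear -h1 h2 hs hA hP hH sH cP iH touch; lia.
have sH' : side (hull K1 K2) = side K1 + side K2.
  by clear -m0 sH; lia.
split=> //.
have disj c : c \in rows Ks -> ~~ intri (hull K1 K2) c.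
  move=> cK; apply/negP => cH.
  have AI0 : #|` A `&` rows Ks| = 0%N.
    by clear -h1 h2 hs hA hP hH sH' cP iH; lia.
  have cA : c \notin A.
    apply/negP => cA; have : c \in A `&` rows Ks by rewrite in_fsetI cA.
    by rewrite (cardfs0_eq AI0) inE.
  have : (#|` c |` A| <= #|` tokens P (hull K1 K2)|)%N.
    apply: fsubset_leq_card; apply/fsubsetP => d; rewrite in_fset1U => /orP[/eqP->|dA].
      by rewrite in_tokens cH EP in_fsetU cK orbT.
    rewrite in_tokens EP in_fsetU dA /=.
    apply: intri_hull; move: dA; rewrite in_fsetU.
    by move=> /orP[/(top_row_intri N1)|/(top_row_intri N2)] ->; rewrite ?orbT.
  rewrite cardfsU1 cA => hH'.
  by clear -h1 h2 hs hA hP hH' sH' cP iH; lia.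
have -> : P = rows Ks `|` top_row K1 `|` top_row K2 by rewrite EP /A fsetUC fsetUA.
rewrite rowsE [top_row (hull _ _) `|` _]fsetUC; apply: reach_merge => //.
have -> : rows Ks `|` top_row K1 `|` top_row K2 = P by rewrite EP /A [RHS]fsetUC fsetUA.
move: N1 N2; rewrite /nonempty => N1 N2.
by clear -N1 N2 cP T0; lia.
Qed.

Lemma rows_perm Ks Ks' : perm_eq Ks Ks' -> rows Ks = rows Ks'.
Proof. exact: perm_big. Qed.

Lemma total_perm Ks Ks' : perm_eq Ks Ks' -> total Ks = total Ks'.
Proof. exact: perm_big. Qed.

(** Each merge shortens the list by one and preserves the total side and the number of tokens. *)
Lemma reach_apart_rows m Ks : (size Ks <= m)%N -> all nonempty Ks ->
  indep (rows Ks) -> #|` rows Ks|%:Z = total Ks ->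
  exists Ks', [/\ pairwise apart Ks', all nonempty Ks', #|` rows Ks|%:Z = total Ks'
    & reach (3 * #|` rows Ks| ^ 2 * m) (rows Ks) (rows Ks')].
Proof.
elim: m Ks => [|m IH] Ks sK nK iK cK.
  move: sK; rewrite leqn0 => /nilP E; subst Ks.
  by exists [::]; split=> //; constructor.
have [sep|[K1 [K2 [Ks1 [Kp touch]]]]] := apart_or_touching Ks.
  by exists Ks; split=> //; constructor.
rewrite (perm_all _ Kp) in nK; rewrite (total_perm Kp) (rows_perm Kp) in cK.
rewrite (rows_perm Kp) in iK *; rewrite (perm_size Kp) in sK.
have [sH H1] := reach_merge_rows nK iK cK touch.
set P := rows [:: K1, K2 & Ks1] in iK cK H1 *.
have cP : #|` rows (hull K1 K2 :: Ks1)| = #|` P| by exact: reach_card H1.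
have [||||Ks' [sep nK' cK' H2]] := IH (hull K1 K2 :: Ks1).
- exact: sK.
- by move: nK => /and3P[N1 N2 Ns]; apply/andP; split=> //;
  rewrite /nonempty sH; move: N1 N2; rewrite /nonempty; clear; lia.
- exact: indep_reach H1 iK.
- by rewrite cP cK !totalE sH addrA.
exists Ks'; split=> //; first by rewrite -cP.
by apply: reach_leq (reach_trans H1 H2); rewrite cP; lia.
Qed.

(** Each token is first viewed as a triangle of side one, whose top row is the token itself; there
    are at most as many merges as tokens. *)
Theorem normal_form P : indep P ->
  exists Ks, [/\ pairwise apart Ks, all nonempty Ks, #|` P|%:Z = total Ks
    & reach (3 * #|` P| ^ 3) P (rows Ks)].
Proof.
move=> iP; pose Ks := [seq ((c.1, c.2, c.1 + c.2) : tri) | c : cell <- P].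
have sideK c : side (c.1, c.2, c.1 + c.2) = 1 by rewrite /side /=; lia.
have rowK (c d : cell) : (d \in top_row (c.1, c.2, c.1 + c.2)) = (d == c).
  by rewrite in_top_row ?sideK // cell_eqE /intri /=; lia.
have EP : rows Ks = P.
  apply/fsetP => c; apply/in_rows/idP => [[K /mapP[d dP ->]]|cP].
    by rewrite rowK => /eqP->.
  by exists (c.1, c.2, c.1 + c.2); [apply: map_f|rewrite rowK].
have cK : #|` rows Ks|%:Z = total Ks.
  rewrite EP /total big_map (eq_bigr (fun=> 1)) => [|c _]; last exact: sideK.
  by rewrite big_const_seq count_predT iter_addr_0 -natz.
have nK : all nonempty Ks by apply/allP => K /mapP[c _ ->]; rewrite /nonempty sideK.
have [||Ks' [sep nK' cK' H]] := @reach_apart_rows #|` P| Ks _ nK _ cK.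
- by rewrite size_map.
- by rewrite EP.
exists Ks'; rewrite EP in cK' H; split=> //.
by apply: reach_leq H; rewrite [in X in (_ <= X)%N]expnSr mulnA.
Qed.

(** * Closures of patterns *)

Lemma closed_row S K : fill_closed S -> (forall c, c \in top_row K -> S c) ->
  forall c, intri K c -> S c.
Proof.
case: K => [[p q] r] cS rS [x y].
(* Induction on the depth below the top row; the second alternative covers cells above that row,
   which have no depth. *)
have [d Ed] : exists d : nat, y = q - d%:Z \/ ~~ intri (p, q, r) (x, y).
  by exists (absz (q - y)%R); rewrite /intri /=; lia.
elim: d x y Ed => [|d IH] x y [Ed|/negP] //; move=> Kc.
  apply: rS; rewrite in_top_row //; first by rewrite Kc andbT /= Ed subr0.
  by move: Kc; rewrite /intri /side /=; lia.
have yq : y = q - d.+1%:Z by [].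
apply: (cS (x - 1, y) (x - 1, y + 1) (x, y + 1)).
- by rewrite /intri /=; lia.
- by rewrite /intri /=; lia.
- by rewrite /intri /=; lia.
- by rewrite cell_eqE /=; lia.
- by apply: IH; [left; lia|move: Kc; rewrite /intri /=; lia].
- by apply: IH; [left; lia|move: Kc; rewrite /intri /=; lia].
Qed.

(** The least closed set containing [X], written as an intersection. *)
Definition fill (X : pattern) (c : cell) : Prop :=
  forall S, fill_closed S -> (forall x, x \in X -> S x) -> S c.

(** [K] and a triangle touching it are replaced by their hull. Since their meet has nonnegative
    side, the side of the hull is at most the sum, even if the two overlap. *)
Lemma absorb_touching K Ks : nonempty K -> all nonempty Ks -> pairwise apart Ks ->
  exists K' Ks', [/\ pairwise apart (K' :: Ks'), {subset Ks' <= Ks},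
    forall c, intri K c -> intri K' c,
    side K' <= side K + total Ks
    & forall J, J \in Ks -> J \in Ks' \/ forall c, intri J c -> intri K' c].
Proof.
have [m] := ubnP (size Ks); elim: m K Ks => // m IH K Ks; rewrite ltnS => sK nK nKs sep.
have [h|/allPn[J JK t]] := boolP (all (apart K) Ks).
  exists K, Ks; split=> //; first by rewrite /= h.
    by have := total_ge0 nKs; lia.
  by left.
have Kp := perm_to_rem JK.
have nJ : nonempty J by apply: (allP nKs).
have [||||K' [Ks' [sep' sub KK sK' cov]]] := IH (hull K J) (rem J Ks).
- rewrite size_rem //; move: sK; case: (Ks) JK => //= *; lia.
- by move: nK nJ; rewrite /nonempty /side /=; clear; lia.
- by apply/allP => I /mem_rem; apply: (allP nKs).
- exact: (subseq_pairwise (rem_subseq _ _) sep).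
exists K', Ks'; split=> //.
- by move=> I /sub /mem_rem.
- by move=> c cK; apply: KK; apply: intri_hull; rewrite cK.
- rewrite (total_perm Kp) totalE; have := side_hull_meet K J.
  move: t; rewrite /apart -leNgt; move: sK'; clear; lia.
- move=> I; rewrite (perm_mem Kp) in_cons => /orP[/eqP->|/cov] //.
  by right=> c cJ; apply: KK; apply: intri_hull; rewrite cJ orbT.
Qed.

(** By the normal form, the closure of [X] is a union of apart triangles whose total side is the
    number of tokens. Whatever [s] adds lies in the one triangle that absorbs, successively, all
    those it touches. *)
Lemma fill_add X s p : indep X -> fill (s |` X) p ->
  fill X p \/ exists K, [/\ intri K s, intri K p & side K <= #|` X|%:Z + 1].
Proof.
move=> iX cl; have [Ks [sep nKs cK H]] := normal_form iX.
have Kcl K c : K \in Ks -> intri K c -> fill X c.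
  move=> KK cKc S cS XS; apply: (closed_row cS) cKc => d dK.
  by apply: (closed_reach cS H XS); apply/in_rows; exists K.
have XKs c : c \in X -> exists2 K, K \in Ks & intri K c.
  apply: (closed_reach (closed_apart sep) (reach_sym H)) => d /in_rows[K KK /(top_row_intri (allP nKs _ KK)) dK].
  by exists K.
pose J : tri := (s.1, s.2, s.1 + s.2).
have sJ : side J = 1 by rewrite /side /J /=; lia.
have [|K' [Ks' [sep' sub JK sK cov]]] := absorb_touching (K := J) _ nKs sep.
  by rewrite /nonempty sJ.
have sK' : intri K' s by apply: JK; rewrite /intri /=; lia.
have [|K] := cl _ (closed_apart sep').
  move=> x; rewrite in_fset1U => /orP[/eqP->|/XKs[K KK Kx]].
    by exists K'; rewrite ?mem_head.
  have [KKs'|Kin] := cov K KK.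
    by exists K => //; rewrite in_cons KKs' orbT.
  by exists K'; rewrite ?mem_head //; apply: Kin.
rewrite in_cons => /orP[/eqP->|/sub KK] pK; last by left; apply: Kcl pK.
by right; exists K'; split=> //; move: sK; rewrite sJ -cK; clear; lia.
Qed.

(** * The upper bound *)

Lemma L_top_row n : (0 < n)%N -> L n = top_row (n%:Z - 1, 0, 0).
Proof.
move=> n0; have K0 : 0 <= side (n%:Z - 1, 0, 0) by rewrite /side /=; lia.
apply/fsetP => -[x y]; rewrite (in_top_row _ K0); apply/in_image_iota/idP.
  by move=> [i si [-> ->]]; rewrite /intri /=; lia.
rewrite /intri /= => h; exists (absz x); first by lia.
by apply: cell_eqP => /=; lia.
Qed.

Lemma card_L n : #|` L n| = n.
Proof.
by rewrite card_imfset /= ?(undup_id (iota_uniq _ _)) ?size_iota // => i j [].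
Qed.

(** Cutting the triangle off at the row of the line leaves a triangle of no larger side, whose top
    row contains all the tokens counted. *)
Lemma indep_L n : indep (L n).
Proof.
move=> [[p q] r] K0.
have inL c : c \in tokens (L n) (p, q, r) -> [&& c.2 == 0, intri (p, q, r) c & 0 <= q].
  rewrite in_tokens => /andP[/in_image_iota[i _ ->]].
  by rewrite /intri /=; lia.
have [E|/fset0Pn[c /inL hc]] := eqVneq (tokens (L n) (p, q, r)) fset0.
  by rewrite E cardfs0.
have J0 : 0 <= side (p, 0, r) by move: hc; rewrite /side /intri /=; lia.
have := card_row J0.
have : (#|` tokens (L n) (p, q, r)| <= #|` top_row (p, 0%R, r)|)%N.
  apply: fsubset_leq_card; apply/fsubsetP => d /inL.
  by rewrite (in_top_row _ J0) /intri /=; lia.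
have : side (p, 0, r) <= side (p, q, r) by move: hc; rewrite /side /intri /=; lia.
by clear; lia.
Qed.

Lemma gamma_reach P Q : gamma P Q -> exists k, reach k P Q.
Proof.
elim=> [|Q1 Q2 _ [k H] /move_step[<-|st]]; first by exists 0%N; constructor.
  by exists k.
by exists (k + 1)%N; apply: reach_trans H (reach1 st).
Qed.

Lemma reach_gamma k P0 P Q : reach k P Q -> gamma P0 P -> gamma P0 Q.
Proof.
by elim=> // {}k P1 Q1 Q2 /step_move st _ IH h; apply: IH; apply: gamma_step h st.
Qed.

Lemma gamma_indep n P : gamma (L n) P -> indep P.
Proof. by move=> /gamma_reach[k /indep_reach]; apply; apply: indep_L. Qed.

(** The union of the apart triangles is closed, so it contains the line. Neighbouring cells of the
    line lie in the same triangle, hence one triangle contains it all; the total side [n] excludes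
    any other and forces its position. *)
Lemma reach_L n P : (0 < n)%N -> gamma (L n) P -> reach (3 * n ^ 3) P (L n).
Proof.
move=> n0 gP; have [k H] := gamma_reach gP.
have [Ks [sep nK cK HK]] := normal_form (gamma_indep gP).
have cP : #|` P| = n by rewrite (reach_card H) card_L.
rewrite cP in cK HK.
have LK c : c \in L n -> exists2 K, K \in Ks & intri K c.
  apply: (closed_reach (closed_apart sep) (reach_sym H)).
  apply: (closed_reach (closed_apart sep) (reach_sym HK)) => d.
  by move=> /in_rows[K KK /(top_row_intri (allP nK _ KK)) dK]; exists K.
have inL i : (i < n)%N -> (i%:Z, 0) \in L n.
  by move=> i_n; apply/in_image_iota; exists i.
have [K KK K0] := LK _ (inL _ n0).
have Ki i : (i < n)%N -> intri K (i%:Z, 0).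
  elim: i => // i IH i_n; have Ki := IH (ltnW i_n).
  have [J JK Ji] := LK _ (inL _ i_n).
  have [-> //|N] := eqVneq K J.
  have := pairwise_mem apart_sym sep KK JK N.
  by rewrite (negPf (@touching_meet K J (i%:Z, -1) (i%:Z, 0) (i.+1%:Z, 0) _ _ Ki Ji)) // /intri /=; lia.
have Kn := Ki n.-1 ltac:(clear -n0; lia).
have Kp := perm_to_rem KK.
have sK : n%:Z <= side K.
  by move: n0 K0 Kn; rewrite /intri /side /=; clear; lia.
have E : rem K Ks = [::].
  have nr : all nonempty (rem K Ks) by apply/allP => J /mem_rem; apply: (allP nK).
  move: cK; rewrite (total_perm Kp) totalE.
  case: (rem K Ks) nr => // J Js /andP[nJ nJs]; have := total_ge0 nJs.
  by move: nJ sK; rewrite totalE /nonempty; clear; lia.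
rewrite E in Kp; rewrite (total_perm Kp) (rows_perm Kp) totalE /total /rows ?big_cons !big_nil in cK HK.
have EK : K = (n%:Z - 1, 0, 0).
  move: cK K0 Kn; rewrite /side /intri; case: (K) => [[p q] r] /= *.
  by congr (_, _, _); lia.
by rewrite L_top_row // -EK; rewrite fsetU0 in HK.
Qed.

(** * Walks and the existence of the diameter *)

Lemma reach_walk n k P Q : reach k P Q -> gamma (L n) P ->
  exists2 k', walk (solitaire_graph n) k' P Q & (k' <= k)%N.
Proof.
elim=> [{}k P' gP|{}k P' Q' Q'' st _ IH gP]; first by exists 0%N; [constructor|].
have gQ : gamma (L n) Q' by apply: gamma_step gP (step_move st).
have [k' w k'k] := IH gQ; exists k'.+1 => //.
by apply: walk_cons w => //; split; [apply: step_neq|left; apply: step_move].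
Qed.

Lemma walk_steps n k P Q : walk (solitaire_graph n) k P Q ->
  exists f : nat -> pattern, [/\ f 0%N = P, f k = Q &
    forall t, (t < k)%N -> step (f t) (f t.+1)].
Proof.
elim=> {k P Q} [P _|k P Q Q' _ [N st] _ [f [f0 fk fs]]]; first by exists (fun=> P).
exists (fun t => if t is t'.+1 then f t' else P); split=> // -[_|t /fs] //=.
rewrite f0; case: st => /move_step[E|h]; [by case: N|exact: h|by case: N|exact: step_sym].
Qed.

Lemma is_distance_ex (V : Type) (G : graph V) x y k : walk G k x y ->
  exists2 d, is_distance G x y d & (d <= k)%N.
Proof.
move=> w; have ex : exists d, `[< walk G d x y >] by exists k; apply/asboolP.
case: (ex_minnP ex) => d /asboolP wd dmin; exists d; last by apply/dmin/asboolP.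
by split=> // l wl; apply/dmin/asboolP.
Qed.

Lemma is_diameter_ex (V : Type) (G : graph V) x0 B : vertex G x0 ->
  (forall x y, vertex G x -> vertex G y -> exists2 k, walk G k x y & (k <= B)%N) ->
  exists2 d, is_diameter G d & (d <= B)%N.
Proof.
move=> G0 GB.
pose A d := `[< exists x y, [/\ vertex G x, vertex G y & is_distance G x y d] >].
have dist x y : vertex G x -> vertex G y ->
    exists d, [/\ is_distance G x y d, A d & (d <= B)%N].
  move=> Gx Gy; have [k w kB] := GB _ _ Gx Gy; have [d wd dk] := is_distance_ex w.
  by exists d; split=> //; [apply/asboolP; exists x, y|apply: leq_trans kB].
have exA : exists d, A d by have [d [_ Ad _]] := dist _ _ G0 G0; exists d.
have AB d : A d -> (d <= B)%N.
  move=> /asboolP[x [y [Gx Gy [wd dmin]]]]; have [k w kB] := GB _ _ Gx Gy.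
  exact: leq_trans (dmin _ w) kB.
case: (ex_maxnP exA AB) => d Ad dmax; exists d; last exact: AB.
split; last exact/asboolP.
by move=> x y Gx Gy; have [k [kd Ak _]] := dist _ _ Gx Gy; exists k; last exact: dmax.
Qed.

Lemma solitaire_diameter_ex n : (0 < n)%N ->
  exists2 d, is_diameter (solitaire_graph n) d & (d <= 6 * n ^ 3)%N.
Proof.
move=> n0; apply: (is_diameter_ex (x0 := L n)); first exact: gamma_refl.
move=> P Q gP gQ; apply: (reach_walk _ gP).
by apply: reach_leq (reach_trans (reach_L n0 gP) (reach_sym (reach_L n0 gQ))); lia.
Qed.

(** * The spiral *)

Definition outside (P : pattern) (K : tri) : pattern := [fset c in P | ~~ intri K c].

Lemma in_outside P K c : (c \in outside P K) = (c \in P) && ~~ intri K c.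
Proof. by rewrite !inE. Qed.

Section Spiral.
Variable o : cell.

(** The triangle spanned by the tokens [0] to [i]. The next token pushes out the right, the diagonal
    and the top side in turn. *)
Definition spiral_tri (i : nat) : tri :=
  (o.1 + ((i + 2) %/ 3)%:Z, o.2 + (i %/ 3)%:Z, o.1 + o.2 - ((i + 1) %/ 3)%:Z).

(** The top right, bottom and top left corner in turn; for positive [i] it is the end of the newest
    side opposite to [token i]. *)
Definition gate (i : nat) : cell :=
  let j := (i %/ 3)%:Z in
  match (i %% 3)%N with
  | 0 => (o.1 + j, o.2 + j)
  | 1 => (o.1 + j + 1, o.2 - j *+ 2 - 1)
  | _ => (o.1 - j *+ 2 - 1, o.2 + j)
  end.

Definition token (i : nat) : cell :=
  if i is i'.+1 then
    let j := (i' %/ 3)%:Z in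
    match (i' %% 3)%N with
    | 0 => (o.1 + j + 1, o.2 + j)
    | 1 => (o.1 + j + 1, o.2 - j *+ 2 - 2)
    | _ => (o.1 - j *+ 2 - 2, o.2 + j + 1)
    end
  else o.

Definition spiral (n : nat) : pattern := [fset token i | i in iota 0 n].

Lemma gateP i :
  [\/ (i %% 3 = 0)%N /\ gate i = (o.1 + (i %/ 3)%:Z, o.2 + (i %/ 3)%:Z),
      (i %% 3 = 1)%N /\ gate i = (o.1 + (i %/ 3)%:Z + 1, o.2 - (i %/ 3)%:Z - (i %/ 3)%:Z - 1) |
      (i %% 3 = 2)%N /\ gate i = (o.1 - (i %/ 3)%:Z - (i %/ 3)%:Z - 1, o.2 + (i %/ 3)%:Z)].
Proof.
have : (i %% 3 < 3)%N by lia.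
rewrite /gate; case E: (i %% 3)%N => [|[|[|//]]] _.
- by constructor 1.
- by constructor 2; split=> //; rewrite mulr2n opprD addrA.
- by constructor 3; split=> //; rewrite mulr2n opprD addrA.
Qed.

Lemma tokenP i :
  [\/ (i %% 3 = 0)%N /\ token i.+1 = (o.1 + (i %/ 3)%:Z + 1, o.2 + (i %/ 3)%:Z),
      (i %% 3 = 1)%N /\ token i.+1 = (o.1 + (i %/ 3)%:Z + 1, o.2 - (i %/ 3)%:Z - (i %/ 3)%:Z - 2) |
      (i %% 3 = 2)%N /\ token i.+1 = (o.1 - (i %/ 3)%:Z - (i %/ 3)%:Z - 2, o.2 + (i %/ 3)%:Z + 1)].
Proof.
have : (i %% 3 < 3)%N by lia.
rewrite /token; case E: (i %% 3)%N => [|[|[|//]]] _.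
- by constructor 1.
- by constructor 2; split=> //; rewrite mulr2n opprD addrA.
- by constructor 3; split=> //; rewrite mulr2n opprD addrA.
Qed.

Lemma side_spiral i : side (spiral_tri i) = i%:Z + 1.
Proof. by rewrite /side /=; lia. Qed.

Lemma spiral_tri_leq i j c : (i <= j)%N -> intri (spiral_tri i) c -> intri (spiral_tri j) c.
Proof. by rewrite /intri /=; lia. Qed.

Lemma token_in i : intri (spiral_tri i) (token i).
Proof.
case: i => [|i]; first by rewrite /intri /=; lia.
by case: (tokenP i) => -[Ei ->]; rewrite /intri /=; lia.
Qed.

Lemma token_notin i j : (i < j)%N -> ~~ intri (spiral_tri i) (token j).
Proof.
case: j => // j ij.
by case: (tokenP j) => -[Ei ->]; rewrite /intri /=; lia.
Qed.

Lemma gate_in i : intri (spiral_tri i) (gate i).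
Proof. by case: (gateP i) => -[Ei ->]; rewrite /intri /=; lia. Qed.

Lemma gate_notin i : ~~ intri (spiral_tri i) (gate i.+1).
Proof. by case: (gateP i.+1) => -[Ei ->]; rewrite /intri /=; lia. Qed.

Lemma gate_neq_token i : gate i.+1 != token i.+1.
Proof.
by case: (gateP i.+1) => -[Ei ->]; case: (tokenP i) => -[Ei' ->]; rewrite cell_eqE /=; lia.
Qed.

Lemma spiralP n c : reflect (exists2 i, (i < n)%N & c = token i) (c \in spiral n).
Proof. exact: in_image_iota. Qed.

Lemma in_spiral_tri n i c : c \in spiral n -> ~~ intri (spiral_tri i) c ->
  exists2 j, (i <= j)%N & c = token j.+1.
Proof.
move=> /spiralP[j _ ->]; case: (leqP j i) => [ji|ij].
  by rewrite (spiral_tri_leq ji (token_in j)).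
by case: j ij => // j ij _; exists j.
Qed.

Lemma gate_notin_spiral n i : gate i.+1 \notin spiral n.
Proof.
apply/negP => /spiralP[j _ E].
have := gate_in i.+1; have := gate_notin i; have := gate_neq_token i; rewrite E.
case: (ltngtP j i.+1) => [ji|ij|->]; last by rewrite eqxx.
- by rewrite (spiral_tri_leq _ (token_in j)).
- by rewrite (negPf (token_notin ij)).
Qed.

Lemma tokens_not_adjacent i j v : (i <= j)%N -> token i.+1 != token j.+1 ->
  ~~ (intri (cellT v) (token i.+1) && intri (cellT v) (token j.+1)).
Proof.
have [-> _|ij _ _] := eqVneq i j; first by rewrite eqxx.
by case: (tokenP i) => -[Ei ->]; case: (tokenP j) => -[Ej ->]; rewrite /intri /=; lia.
Qed.

Lemma adjacent_token i j v a : (i <= j)%N -> intri (spiral_tri i) a ->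
  intri (cellT v) a -> intri (cellT v) (token j.+1) -> a = gate i.
Proof.
case: a => x y ij; case: (tokenP j) => -[Ej ->]; case: (gateP i) => -[Ei ->];
  rewrite /intri /= => h1 h2 h3; apply: cell_eqP => /=; lia.
Qed.

(** A token outside the triangle is a spiral token without a partner: the only cell inside that can
    be near it is the gate, which is empty, and no other token outside is near it. *)
Lemma spiral_step_in n i (P : pattern) v a c :
  (forall d, ~~ intri (spiral_tri i) d -> (d \in P) = (d \in spiral n)) ->
  gate i \notin P -> intri (cellT v) a -> intri (cellT v) c -> a != c ->
  a \in P -> c \in P -> intri (spiral_tri i) a.
Proof.
move=> fr gP Ta Tc ac aP cP; apply/negPn/negP => Na.
have := aP; rewrite fr // => /in_spiral_tri /(_ Na) [j ij Ea].
have [Kc|Nc] := boolP (intri (spiral_tri i) c).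
  by move: gP; rewrite -(adjacent_token (j := j) ij Kc Tc) ?cP // -Ea.
have := cP; rewrite fr // => /in_spiral_tri /(_ Nc) [k ik Ec].
subst a c; have /orP[jk|kj] := leq_total j k.
  by have := tokens_not_adjacent v jk ac; rewrite Ta Tc.
by have := tokens_not_adjacent v kj; rewrite eq_sym Ta Tc => /(_ ac).
Qed.

Lemma hull_token i : let J := ((token i.+1).1, (token i.+1).2, (token i.+1).1 + (token i.+1).2) in
  hull (spiral_tri i) J = spiral_tri i.+1 /\ side (meet (spiral_tri i) J) = 0.
Proof.
case: (tokenP i) => -[Ei ->] /=; (split; [rewrite /hull /=; congr (_, _, _)|rewrite /side /=]; lia).
Qed.

(** This serves only to put the spiral in the orbit, so the number of steps is left open. The tokens
    are merged one by one, each as a triangle of side one touching the previous triangle. *)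
Lemma spiral_reach n i : (i < n)%N -> exists k, reach k (spiral n)
  (outside (spiral n) (spiral_tri i) `|` top_row (spiral_tri i)).
Proof.
elim: i => [|i IH] i_n.
  exists 0%N; rewrite [X in reach _ _ X](_ : _ = spiral n); first by constructor.
  apply/fsetP => c; rewrite in_fsetU in_top_row ?side_spiral // in_outside.
  have [cs|cs] := boolP (c \in spiral n) => /=.
    by case: (boolP (intri _ _)) => //; rewrite /intri /=; lia.
  apply/negP => h; move/negP: cs; apply; apply/spiralP; exists 0%N => //.
  by move: h; rewrite /intri /=; case: c => x y /= h; apply: cell_eqP => /=; lia.
have [k H] := IH (ltnW i_n).
pose J : tri := ((token i.+1).1, (token i.+1).2, (token i.+1).1 + (token i.+1).2).
have [hJ mJ] := hull_token i; rewrite -/J in hJ mJ.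
have sJ : side J = 1 by rewrite /side /J /=; lia.
have rJ : top_row J = [fset token i.+1].
  by apply/fsetP => c; rewrite in_top_row ?sJ // !inE cell_eqE /intri /=; lia.
have M := @reach_merge (spiral_tri i) J (outside (spiral n) (spiral_tri i.+1)) i.+2.
rewrite hJ in M; exists (k + 3 * i.+2 ^ 2)%N; apply: reach_trans H _.
rewrite [X in reach _ X _](_ : _ = (outside (spiral n) (spiral_tri i.+1))
    `|` top_row (spiral_tri i) `|` top_row J).
  apply: M; rewrite ?side_spiral ?sJ //; [lia|lia|].
  by move=> c; rewrite in_outside => /andP[].
rewrite rJ fsetUAC; congr (_ `|` _); apply/fsetP => c; rewrite in_fsetU !in_outside in_fset1.
have [E|N] := eqVneq c (token i.+1).
  rewrite E token_notin // andbT orbT.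
  by apply/spiralP; exists i.+1.
rewrite orbF; have [cs|//] := boolP (c \in spiral n); rewrite /=.
apply/idP/idP => Nc; last by apply: contra Nc; apply: spiral_tri_leq.
have [j ij Ej] := in_spiral_tri cs Nc.
rewrite Ej; apply: token_notin; move: ij; rewrite leq_eqVlt => /orP[/eqP Eij|//].
by rewrite Ej -Eij eqxx in N.
Qed.
End Spiral.

(** * The lower bound *)

Definition step_in (K : tri) (P Q : pattern) : Prop :=
  exists v a b c, step_at v a b c P Q /\ [/\ intri K a, intri K b & intri K c].

Lemma fill_sub X Y p : {subset X <= Y} -> fill X p -> fill Y p.
Proof. by move=> XY fX S cS YS; apply: (fX S cS) => x /XY; apply: YS. Qed.

(* A step inside [K] can newly fill [g] from within [D] only by bringing a token [b] into [D];
   the full triangle that then contains [g] also contains [b]. *)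
Lemma fill_window K D P Q g (W : int) : indep P -> step_in K P Q ->
  (forall v a b, intri (cellT v) a -> intri (cellT v) b -> intri K a -> ~~ intri D a ->
     intri D b -> forall J, intri J b -> intri J g -> W <= side J) ->
  fill (tokens Q D) g -> fill (tokens P D) g \/ W <= #|` tokens Q D|%:Z.
Proof.
move=> iP [v [a [b [c [[[Ta Tb Tc] [aP cP ac bP] ->] [Ka Kb Kc]]]]]] bd H.
have [Db|Db] := boolP (intri D b); last first.
  left; apply: fill_sub H => x; rewrite !in_tokens !inE => /andP[/orP[/eqP->|/andP[_ ->]]] //.
  by rewrite (negPf Db).
have ab : a != b by apply: contraNneq bP => <-.
have [Da|Da] := boolP (intri D a).
  have Dc := tri_closed Ta Tb Tc ab Da Db.
  left; move=> S cS XS; apply: (H S cS) => x; rewrite !in_tokens !inE => /andP[/orP[/eqP->|/andP[_ xP]] xD].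
    by apply: (cS _ _ _ _ Ta Tc Tb ac); apply: XS; rewrite in_tokens ?aP ?cP.
  by apply: XS; rewrite in_tokens xP.
have E : tokens (b |` P `\ a) D = b |` tokens P D.
  apply/fsetP => x; rewrite in_fset1U !in_tokens !inE.
  have [->|_] := eqVneq x b; first by rewrite Db.
  by have [->|_] := eqVneq x a; rewrite //= (negPf Da) andbF.
have iX : indep (tokens P D).
  by apply: indep_sub iP => x; rewrite in_tokens => /andP[].
move: H; rewrite E => /(fill_add iX) [|[J [Jb Jg sJ]]]; first by left.
right; rewrite cardfsU1 in_tokens (negPf bP).
by have := bd _ _ _ Ta Tb Ka Da Db _ Jb Jg; move: sJ; clear; lia.
Qed.

(** * Weights of patterns *)

Definition weight (F : cell -> int) (K : tri) (P : pattern) : int :=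
  \sum_(c <- tokens P K) F c.

Lemma weight_step F K P Q : (forall v a b, intri (cellT v) a -> intri (cellT v) b ->
    F a <= F b + 1) -> step_in K P Q -> weight F K P <= weight F K Q + 1.
Proof.
move=> lipF [v [a [b [c [[[Ta Tb Tc] [aP cP ac bP] ->] [Ka Kb Kc]]]]]].
have -> : weight F K (b |` P `\ a) = F b + \sum_(x <- tokens P K `\ a) F x.
  have -> : weight F K (b |` P `\ a) = \sum_(x <- b |` (tokens P K `\ a)) F x.
    rewrite /weight (_ : tokens _ _ = b |` (tokens P K `\ a)) //.
    apply/fsetP => x; rewrite in_tokens !inE.
    have [->|_] := eqVneq x b; first by rewrite Kb.
    by rewrite andbA.
  by rewrite big_fsetU1 //= !inE (negPf bP) andbF.
rewrite /weight (big_fsetD1 a) /=; last by rewrite in_tokens aP.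
by rewrite addrAC lerD2r; apply: lipF Ta Tb.
Qed.

Lemma step_in_sym K P Q : step_in K P Q -> step_in K Q P.
Proof.
by move=> [v [a [b [c [/step_at_sym st [Ka Kb Kc]]]]]]; exists v, b, a, c.
Qed.

Lemma weight_ge F K D P g : (forall c, 0 <= F c) -> (forall c, intri D c -> intri K c) ->
  (forall c, intri D c -> g <= F c) -> g * #|` tokens P D|%:Z <= weight F K P.
Proof.
move=> F0 DK gF; rewrite /weight (big_fsetID _ (intri D)) /=.
have -> : [fset x | x in tokens P K & intri D x] = tokens P D.
  apply/fsetP => x; rewrite !inE /=.
  by case: (boolP (intri D x)) => [/DK->|_]; rewrite ?andbT ?andbF.
have h2 : 0 <= \sum_(i <- [fset x | x in tokens P K & ~~ intri D x]) F i.
  by apply: sumr_ge0 => i _; apply: F0.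
suff h1 : g * #|` tokens P D|%:Z <= \sum_(i <- tokens P D) F i.
  by apply: le_trans h1 _; rewrite lerDl.
have -> : g * #|` tokens P D|%:Z = \sum_(i <- tokens P D) g.
  by rewrite big_const_seq count_predT iter_addr_0 -mulr_natr natz.
by rewrite big_seq [leRHS]big_seq; apply: ler_sum => i; rewrite in_tokens => /andP[_ /gF].
Qed.

Section LowerBound.
Variables (o : cell) (n M : nat) (f : nat -> pattern).
Hypothesis f0 : f 0%N = spiral o n.
Hypothesis f_step : forall t, (t < M)%N -> step (f t) (f t.+1).
Hypothesis f_indep : forall t, (t <= M)%N -> indep (f t).

Definition first_visit i t : Prop :=
  [/\ (t <= M)%N, gate o i \in f t & forall s, (s < t)%N -> gate o i \notin f s].

(** By [spiral_step_in], no move touches a cell outside the triangle while the gate is empty.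
    Emptiness is assumed strictly before [t], so the conclusion still holds at the first visit. *)
Lemma frozen i t : (t <= M)%N -> (forall s, (s < t)%N -> gate o i \notin f s) ->
  forall d, ~~ intri (spiral_tri o i) d -> (d \in f t) = (d \in spiral o n).
Proof.
elim: t => [|t IH] tM ng d Nd; first by rewrite f0.
have fr := IH (ltnW tM) (fun s st => ng s (ltnW st)).
have gt := ng t (ltnSn t).
have [v [a [b [c [[Ta Tb Tc] [aP cP ac bP] E]]]]] := f_step tM.
have Ka := spiral_step_in fr gt Ta Tc ac aP cP.
have Kc : intri (spiral_tri o i) c.
  by apply: (spiral_step_in fr gt Tc Ta) => //; rewrite eq_sym.
have Kb := tri_closed Ta Tc Tb ac Ka Kc.
rewrite -fr // E !inE.
have [Ed|_] := eqVneq d b; first by rewrite Ed Kb in Nd.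
by have [Ed|_] := eqVneq d a; first by rewrite Ed Ka in Nd.
Qed.

Lemma frozen_step i t1 t : first_visit i t1 -> (t < t1)%N ->
  step_in (spiral_tri o i) (f t) (f t.+1).
Proof.
move=> [t1M _ ng] tt1; have tM : (t < M)%N by apply: leq_trans t1M.
have fr := frozen (ltnW tM) (fun s st => ng s (ltn_trans st tt1)).
have [v [a [b [c [[Ta Tb Tc] [aP cP ac bP] E]]]]] := f_step tM.
have Ka := spiral_step_in fr (ng t tt1) Ta Tc ac aP cP.
have Kc : intri (spiral_tri o i) c.
  by apply: (spiral_step_in fr (ng t tt1) Tc Ta) => //; rewrite eq_sym.
by exists v, a, b, c; split=> //; split=> //; apply: (tri_closed Ta Tc Tb ac Ka Kc).
Qed.

(** Up to the first visit to gate [i], the next gate is a frozen cell without a token. *)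
Lemma first_visit_lt i t0 t1 : first_visit i t0 -> first_visit i.+1 t1 -> (t0 < t1)%N.
Proof.
move=> [t0M _ ng0] [t1M g1 _]; rewrite ltnNge; apply/negP => t10.
move: g1; rewrite (frozen t1M (fun s st => ng0 s (leq_trans st t10)) (gate_notin o i)).
by rewrite (negPf (gate_notin_spiral _ _ _)).
Qed.

(** At [t0] the closure of the tokens in [D] misses the next gate, while at [t1] this gate is itself
    a token. At the step where it becomes filled, [fill_window] gives the count. *)
Lemma window_crowded i D (W : int) t0 t1 : first_visit i t0 -> first_visit i.+1 t1 ->
  (forall c, intri D c -> intri (spiral_tri o i.+1) c) ->
  intri D (gate o i.+1) -> ~~ intri D (token o i.+1) ->
  (forall v a b, intri (cellT v) a -> intri (cellT v) b ->
     intri (spiral_tri o i.+1) a -> ~~ intri D a -> intri D b ->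
     forall J, intri J b -> intri J (gate o i.+1) -> W <= side J) ->
  exists t, [/\ (t0 < t)%N, (t <= t1)%N & W <= #|` tokens (f t) D|%:Z].
Proof.
move=> fv0 fv1 DK Dg Dt bd; apply: contrapT => none.
have t01 := first_visit_lt fv0 fv1.
have nofill e : (t0 + e <= t1)%N -> ~ fill (tokens (f (t0 + e)%N) D) (gate o i.+1).
  elim: e => [|e IH] et1 fl.
    suff : intri (spiral_tri o i) (gate o i.+1) by rewrite (negPf (gate_notin o i)).
    apply: (fl (fun c => intri (spiral_tri o i) c)) => [v a b c|x]; first exact: tri_closed.
    rewrite addn0 in_tokens => /andP[xf xD]; apply/negPn/negP => Nx.
    (* Outside the old triangle the pattern is still the spiral, whose only token in the new
       triangle but not in the old one is [token i.+1], excluded from [D]. *)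
    have [t0M _ ng] := fv0; move: xf; rewrite (frozen t0M ng Nx) => xs.
    have [j ij Ej] := in_spiral_tri xs Nx.
    move: ij; rewrite leq_eqVlt => /orP[/eqP Eij|ij].
      by move: Dt; rewrite Eij -Ej xD.
    by have := DK _ xD; rewrite Ej (negPf (token_notin o (i := i.+1) (j := j.+1) ij)).
  have et : (t0 + e < t1)%N by rewrite -addnS.
  have [t1M _ _] := fv1.
  have ie : indep (f (t0 + e)%N) by apply/f_indep/(leq_trans (ltnW et) t1M).
  rewrite addnS in fl; have [|crowded] := fill_window ie (frozen_step fv1 et) bd fl.
    by apply: IH; apply: ltnW.
  by apply: none; exists (t0 + e).+1; split=> //; rewrite ltnS leq_addr.
have [t1M g1 _] := fv1.
have := nofill (t1 - t0)%N; rewrite subnKC ?(ltnW t01) // => /(_ (leqnn _)); apply.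
by move=> S _; apply; rewrite in_tokens g1.
Qed.


Lemma weight_drift F i t1 s e :
  (forall v a b, intri (cellT v) a -> intri (cellT v) b -> F a <= F b + 1) ->
  first_visit i t1 -> (s + e <= t1)%N ->
  weight F (spiral_tri o i) (f s) <= weight F (spiral_tri o i) (f (s + e)%N) + e%:Z /\
  weight F (spiral_tri o i) (f (s + e)%N) <= weight F (spiral_tri o i) (f s) + e%:Z.
Proof.
move=> lipF fv; elim: e => [|e IH] et1; first by rewrite addn0 addr0.
rewrite addnS in et1 *; have [h1 h2] := IH (ltnW et1).
have st := frozen_step fv et1.
have := weight_step lipF st; have := weight_step lipF (step_in_sym st).
by move: h1 h2; clear; lia.
Qed.

(* The windows at the three gates of one turn hold [5h - 3] tokens each, out of [12h + 3];
   they are pairwise at distance more than [2h], so the tokens counted twice must travel. *)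
Lemma turn_cost h t0 t1 t2 t3 : (0 < h)%N ->
  first_visit (12 * h).-1 t0 -> first_visit (12 * h) t1 ->
  first_visit (12 * h).+1 t2 -> first_visit (12 * h).+2 t3 ->
  (t0 + 3 * h * (h - 4) <= t3)%N.
Proof.
move=> h0 fv0 fv1 fv2 fv3; pose W : int := 5 * h%:Z - 3.
have Eh : (12 * h).-1.+1 = (12 * h)%N by rewrite prednK // muln_gt0.
have g1 : gate o (12 * h) = (o.1 + 4 * h%:Z, o.2 + 4 * h%:Z).
  by case: (gateP o (12 * h)) => -[E ->]; apply: cell_eqP => /=; lia.
have g2 : gate o (12 * h).+1 = (o.1 + 4 * h%:Z + 1, o.2 - 8 * h%:Z - 1).
  by case: (gateP o (12 * h).+1) => -[E ->]; apply: cell_eqP => /=; lia.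
have g3 : gate o (12 * h).+2 = (o.1 - 8 * h%:Z - 1, o.2 + 4 * h%:Z).
  by case: (gateP o (12 * h).+2) => -[E ->]; apply: cell_eqP => /=; lia.
have k1 : token o (12 * h) = (o.1 - 8 * h%:Z, o.2 + 4 * h%:Z).
  rewrite -Eh; case: (tokenP o (12 * h).-1) => -[E ->]; apply: cell_eqP => /=; lia.
have k2 : token o (12 * h).+1 = (o.1 + 4 * h%:Z + 1, o.2 + 4 * h%:Z).
  by case: (tokenP o (12 * h)) => -[E ->]; apply: cell_eqP => /=; lia.
have k3 : token o (12 * h).+2 = (o.1 + 4 * h%:Z + 1, o.2 - 8 * h%:Z - 2).
  by case: (tokenP o (12 * h).+1) => -[E ->]; apply: cell_eqP => /=; lia.
(* Each window is the triangle of side [W] in the corner of its gate, so a triangle from its inner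
   side to the gate has side at least [W]. *)
pose D1 : tri := (o.1 + 4 * h%:Z, o.2 + 4 * h%:Z, o.1 + o.2 + 8 * h%:Z - W + 1).
pose D2 : tri := (o.1 + 4 * h%:Z + 1, o.2 - 8 * h%:Z + W - 2, o.1 + o.2 - 4 * h%:Z).
pose D3 : tri := (o.1 - 8 * h%:Z + W - 2, o.2 + 4 * h%:Z, o.1 + o.2 - 4 * h%:Z - 1).
have W1 : 1 <= W by rewrite /W; clear -h0; lia.
have [|||||s1 [ts1 st1 w1]] := @window_crowded (12 * h).-1 D1 W t0 t1 fv0.
- by rewrite Eh.
- by rewrite Eh /D1 /intri /= => -[x y] /=; lia.
- by rewrite Eh g1 /D1 /intri /=; lia.
- by rewrite Eh k1 /D1 /intri /=; lia.
- by rewrite Eh g1 /D1 /intri /side /= => -[v w] [x y] [x' y'] /= ? ? ? ? ? [[p q] r] /=; lia.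
have [||||s2 [ts2 st2 w2]] := @window_crowded (12 * h) D2 W t1 t2 fv1 fv2.
- by rewrite /D2 /intri /= => -[x y] /=; lia.
- by rewrite g2 /D2 /intri /=; lia.
- by rewrite k2 /D2 /intri /=; lia.
- by rewrite g2 /D2 /intri /side /= => -[v w] [x y] [x' y'] /= ? ? ? ? ? [[p q] r] /=; lia.
have [||||s3 [ts3 st3 w3]] := @window_crowded (12 * h).+1 D3 W t2 t3 fv2 fv3.
- by rewrite /D3 /intri /= => -[x y] /=; lia.
- by rewrite g3 /D3 /intri /=; lia.
- by rewrite k3 /D3 /intri /=; lia.
- by rewrite g3 /D3 /intri /side /= => -[v w] [x y] [x' y'] /= ? ? ? ? ? [[p q] r] /=; lia.
(* A distance from a side of the final triangle becomes a potential between [0] and [h]. It equals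
   [h] from distance [7h + 5] on, hence on the whole window opposite to that side. *)
pose clip (z : int) := Num.min h%:Z (Num.max 0 (z - (6 * h%:Z + 5))).
pose F1 (c : cell) := clip (c.1 + c.2 - (o.1 + o.2 - 4 * h%:Z - 1)).
pose F2 (c : cell) := clip (o.2 + 4 * h%:Z - c.2).
pose F3 (c : cell) := clip (o.1 + 4 * h%:Z + 1 - c.1).
set K := spiral_tri o (12 * h).+2.
have KE : K = (o.1 + 4 * h%:Z + 1, o.2 + 4 * h%:Z, o.1 + o.2 - 4 * h%:Z - 1).
  by rewrite /K /spiral_tri; congr (_, _, _); lia.
have lip1 v a b : intri (cellT v) a -> intri (cellT v) b -> F1 a <= F1 b + 1.
  by rewrite /F1 /clip /intri /=; clear; lia.
have lip2 v a b : intri (cellT v) a -> intri (cellT v) b -> F2 a <= F2 b + 1.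
  by rewrite /F2 /clip /intri /=; clear; lia.
have lip3 v a b : intri (cellT v) a -> intri (cellT v) b -> F3 a <= F3 b + 1.
  by rewrite /F3 /clip /intri /=; clear; lia.
have big1 P : h%:Z * #|` tokens P D1|%:Z <= weight F1 K P.
  apply: weight_ge => c; rewrite ?KE /F1 /clip /intri /D1 /W /=; clear; lia.
have big2 P : h%:Z * #|` tokens P D2|%:Z <= weight F2 K P.
  apply: weight_ge => c; rewrite ?KE /F2 /clip /intri /D2 /W /=; clear; lia.
have big3 P : h%:Z * #|` tokens P D3|%:Z <= weight F3 K P.
  apply: weight_ge => c; rewrite ?KE /F3 /clip /intri /D3 /W /=; clear; lia.
have [t3M _ _] := fv3.
have s2M : (s2 <= M)%N by clear -t3M st2 ts3 st3; lia.
(* The distances of a cell of [K] from the three sides add up to [12h + 2], while a positive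
   potential takes more than [6h + 5]: at most one of the three is positive. *)
have sum_le : weight F1 K (f s2) + weight F2 K (f s2) + weight F3 K (f s2)
    <= h%:Z * (12 * h%:Z + 3).
  have K0 : 0 <= side K by rewrite KE /side /=; clear; lia.
  apply: (@le_trans _ _ (h%:Z * #|` tokens (f s2) K|%:Z)); last first.
    apply: ler_wpM2l => //; apply: le_trans (f_indep s2M K0) _.
    by rewrite KE /side /=; clear; lia.
  have -> : h%:Z * #|` tokens (f s2) K|%:Z = \sum_(i <- tokens (f s2) K) h%:Z.
    by rewrite big_const_seq count_predT iter_addr_0 -mulr_natr natz.
  rewrite /weight -!big_split /= big_seq [leRHS]big_seq; apply: ler_sum => c.
  rewrite in_tokens KE => /andP[_]; rewrite /F1 /F2 /F3 /clip /intri /=; clear; lia.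
have e1 : (s1 + (s2 - s1) = s2)%N by clear -st1 ts2; lia.
have e3 : (s2 + (s3 - s2) = s3)%N by clear -st2 ts3; lia.
have [|d1 _] := @weight_drift F1 (12 * h).+2 t3 s1 (s2 - s1) lip1 fv3.
  by rewrite e1; clear -st2 ts3 st3; lia.
have [|_ d3] := @weight_drift F3 (12 * h).+2 t3 s2 (s3 - s2) lip3 fv3.
  by rewrite e3.
rewrite -/K e1 in d1; rewrite -/K e3 in d3.
have b1 := big1 (f s1); have b2 := big2 (f s2); have b3 := big3 (f s3).
have hW u : W <= u -> h%:Z * W <= h%:Z * u by apply: ler_wpM2l.
have {w1} w1 := hW _ w1; have {w2} w2 := hW _ w2; have {w3} w3 := hW _ w3.
move: w1 w2 w3 b1 b2 b3 d1 d3 sum_le.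
(* The excess of three saturated windows over the weight available at [s2]; the drift of [F1] before
   [s2] and of [F3] after it must supply it. *)
have : h%:Z * W + h%:Z * W + h%:Z * W - h%:Z * (12 * h%:Z + 3) = 3 * h%:Z * (h%:Z - 4).
  by rewrite /W; ring.
move=> E w1 w2 w3 b1 b2 b3 d1 d3 sum_le.
have : 3 * h%:Z * (h%:Z - 4) <= (s3 - s1)%N%:Z.
  rewrite -E; clear E; move: w1 w2 w3 b1 b2 b3 d1 d3 sum_le.
  by clear -st1 ts2 st2 ts3; lia.
clear -ts1 st1 ts2 st2 ts3 st3; have [h4|h4] := leqP h 4.
  by have -> : (h - 4 = 0)%N by [lia]; rewrite muln0; lia.
have [e Ee] : exists e, h = (e + 4)%N by exists (h - 4)%N; lia.
by rewrite Ee addnK; lia.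
Qed.

(** If the gate stayed empty, [token i.+1] would still be in place at time [M]. *)
Lemma first_visit_ex i : (i.+1 < n)%N -> token o i.+1 \notin f M -> exists t, first_visit i t.
Proof.
move=> i_n tM.
have ex : exists t, (t <= M)%N && (gate o i \in f t).
  apply: contrapT => none; move/negP: tM; apply.
  rewrite (frozen (i := i) (leqnn M)); first by apply/spiralP; exists i.+1.
    by move=> s sM; apply/negP => gs; apply: none; exists s; rewrite (ltnW sM).
  exact: token_notin.
case: (ex_minnP ex) => t /andP[tM' gt] tmin; exists t; split=> // s st.
apply/negP => gs; have := tmin s; rewrite gs andbT (leq_trans (ltnW st) tM').
by move=> /(_ isT); rewrite leqNgt st.
Qed.

(** * Summing over the turns *)

Section Visits.
Variable I : nat.
Hypothesis visited : forall i, (i <= I)%N -> exists t, first_visit i t.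

Lemma first_visit_leq i j t t' : (i <= j <= I)%N ->
  first_visit i t -> first_visit j t' -> (t <= t')%N.
Proof.
elim: j t' => [|j IH] t' /andP[ij jI] fv fv'.
  move: ij fv; rewrite leqn0 => /eqP-> [_ _ ng]; have [_ g' _] := fv'.
  by rewrite leqNgt; apply/negP => /ng; rewrite g'.
move: ij; rewrite leq_eqVlt => /orP[/eqP E|ij].
  move: fv; rewrite E => -[_ _ ng]; have [_ g' _] := fv'.
  by rewrite leqNgt; apply/negP => /ng; rewrite g'.
have [s fvs] := visited (ltnW jI).
apply: leq_trans (ltnW (first_visit_lt fvs fv')).
by apply: IH fv fvs; rewrite -ltnS ij ltnW.
Qed.

(** The multiples of [12] select one turn out of four. Each costs at least as much as the turn at
    [h], and [first_visit_leq] bridges the turns in between. *)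
Lemma turns_cost h e t : (0 < h)%N -> ((12 * (h + e)).-1 <= I)%N ->
  first_visit (12 * (h + e)).-1 t -> (e * (3 * h * (h - 4)) <= t)%N.
Proof.
move=> h0; elim: e t => [|e IH] t eI fv; first by rewrite mul0n.
have [t0 fv0] : exists t0, first_visit (12 * (h + e)).-1 t0 by apply: visited; lia.
have [t1 fv1] : exists t1, first_visit (12 * (h + e)) t1 by apply: visited; lia.
have [t2 fv2] : exists t2, first_visit (12 * (h + e)).+1 t2 by apply: visited; lia.
have [t3 fv3] : exists t3, first_visit (12 * (h + e)).+2 t3 by apply: visited; lia.
have h1 : (e * (3 * h * (h - 4)) <= t0)%N by apply: IH fv0; lia.
have h2 : (t0 + 3 * (h + e) * (h + e - 4) <= t3)%N.
  by apply: turn_cost fv0 fv1 fv2 fv3; lia.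
have h3 : (t3 <= t)%N by apply: first_visit_leq fv3 fv; lia.
have h4 : (3 * h * (h - 4) <= 3 * (h + e) * (h + e - 4))%N by apply: leq_mul; lia.
by rewrite mulSn; clear -h1 h2 h3 h4; lia.
Qed.
End Visits.

End LowerBound.

(** * The distance from the spiral to the line *)

Section LineSpiral.
Variable n : nat.
Hypothesis n_gt0 : (0 < n)%N.

(* The centre for which the outermost triangle of the spiral is the one below [L n]. *)
Let o : cell := (n%:Z - 1 - ((n + 1) %/ 3)%:Z, - ((n - 1) %/ 3)%:Z).

Lemma gamma_spiral : gamma (L n) (spiral o n).
Proof.
have [|k H] := @spiral_reach o n n.-1; first by rewrite prednK.
apply: (reach_gamma (reach_sym _) (gamma_refl _)).
rewrite L_top_row //.
suff <- : outside (spiral o n) (spiral_tri o n.-1) `|` top_row (spiral_tri o n.-1)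
    = top_row (n%:Z - 1, 0, 0) by exact: H.
have -> : spiral_tri o n.-1 = (n%:Z - 1, 0, 0).
  by rewrite /spiral_tri /o /=; congr (_, _, _); lia.
rewrite (_ : outside _ _ = fset0) ?fset0U //.
apply/fsetP => c; rewrite in_outside inE; apply/negP => /andP[/spiralP[j jn ->]].
have -> : (n%:Z - 1, 0, 0) = spiral_tri o n.-1.
  by rewrite /spiral_tri /o /=; congr (_, _, _); lia.
by rewrite (spiral_tri_leq _ (token_in o j)) //; lia.
Qed.

(** The top of the triangle of [i] rises at every third index, so at least three indices before
    [n - 1] it is still below the row of the line. *)
Lemma token_notin_L i : (i + 4 <= n)%N -> token o i \notin L n.
Proof.
move=> i_n; rewrite L_top_row // in_top_row; last by rewrite /side /=; lia.
by have := token_in o i; rewrite /intri /=; lia.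
Qed.

Lemma walk_spiral_L k : (200 <= n)%N -> walk (solitaire_graph n) k (spiral o n) (L n) ->
  (n ^ 3 <= 48 ^ 3 * k)%N.
Proof.
move=> n200 w; have [f [f0 fk fs]] := walk_steps w.
have f_indep t : (t <= k)%N -> indep (f t).
  elim: t => [|t IH] tk; first by rewrite f0; apply: gamma_indep gamma_spiral.
  exact: indep_step (fs _ tk) (IH (ltnW tk)).
have visited i : (i <= n - 5)%N -> exists t, first_visit o k f i t.
  move=> i_n; apply: (first_visit_ex f0 fs); first by lia.
  by rewrite fk; apply: token_notin_L; lia.
(* The selected turns range from [12h] up to [24h], and [24h - 1 <= n - 5] keeps their gates among
   the visited ones. The bound [h >= 6] gives [3 * (h - 4) >= h], hence a cost of at least
   [h ^ 3]. *)
pose h := ((n - 4) %/ 24)%N.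
have h6 : (6 <= h)%N by rewrite /h; lia.
have hn : (n <= 48 * h)%N by rewrite /h; lia.
have hI : ((12 * (h + h)).-1 <= n - 5)%N by rewrite /h; lia.
have [t fv] := visited _ hI.
have := turns_cost f0 fs f_indep visited (ltac:(lia) : (0 < h)%N) hI fv.
have [tk _ _] := fv => ht.
rewrite -(leq_exp2r _ _ (isT : (0 < 3)%N)) expnMn in hn; apply: leq_trans hn _.
rewrite leq_mul2l; apply/orP; right; apply: leq_trans tk; apply: leq_trans ht.
by rewrite expnS -mulnn leq_mul2l; apply/orP; right; clear -h6; nia.
Qed.
End LineSpiral.

Theorem theorem4 (R : realType) :
  exists c C : R, 0 < c /\ c < C /\
    exists N : nat, forall n : nat, (N <= n)%N ->
      exists d : nat, is_diameter (solitaire_graph n) d /\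
        c * n%:R ^+ 3 <= d%:R /\ d%:R <= C * n%:R ^+ 3.
Proof.
have c0 : (0 : R) < 48%:R ^+ 3 by rewrite exprn_gt0 // ltr0n.
(* The lower constant comes from [n <= 48h], the upper one from passing through [L n] with at most
   [3 * n ^ 3] steps on either side. *)
exists (48%:R ^+ 3)^-1, 6%:R; split; first by rewrite invr_gt0.
split.
  apply: (@le_lt_trans _ _ 1); last by rewrite ltr1n.
  by rewrite invf_le1 // exprn_ege1 // ler1n.
exists 200%N => n n200; have n0 : (0 < n)%N by apply: leq_trans n200.
have [d diam_d d_le] := solitaire_diameter_ex n0; exists d; split=> //.
split; last by rewrite -natrX -natrM ler_nat.
rewrite mulrC ler_pdivrMr // mulrC -!natrX -natrM ler_nat.
have [k [w _] kd] := diam_d.1 _ _ (gamma_spiral n0) (gamma_refl _).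
by apply: leq_trans (walk_spiral_L n0 n200 w) _; rewrite leq_mul2l kd orbT.
Qed.
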